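(* Let $k \geq 2$ be an integer. For every finite simple graph $G$ we have $\chi'_{k}(G) \leq 177k - 93$.
   Context: All graphs are finite and simple. For an integer $k \geq 2$, a $\chi'_{k}$-coloring of a graph $G$ is a coloring of the edges of $G$ (each edge receives exactly one color; adjacent edges may share a color) such that, for each color, the subgraph induced by the edges of that color has all its degrees congruent to $1 \pmod k$. Here the subgraph induced by a set of edges has as its vertices exactly the endpoints of those edges; so the condition says that for every vertex $v$ and every color $c$, the number of edges of color $c$ incident with $v$ is either $0$ or congruent to $1 \pmod k$. The mod $k$ chromatic index $\chi'_{k}(G)$ is the minimum number of colors in a $\chi'_{k}$-coloring of $G$. *)

(* Defs.v *)
From mathcomp Require Import all_boot.

Set Implicit Arguments.
Unset Strict Implicit.
Unset Printing Implicit Defensive.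

Record sgraph := SGraph {
  vertex :> finType;
  adj : rel vertex;
  adj_sym : symmetric adj;
  adj_irrefl : irreflexive adj
}.

Definition edges (G : sgraph) : {set {set G}} :=
  [set [set p.1; p.2] | p in [pred p : G * G | adj p.1 p.2]].

Definition edge (G : sgraph) : finType := {e : {set G} | e \in edges G}.

(* Vertex set of the subgraph induced by F: exactly the endpoints of the
   edges of F. *)
Definition ends (G : sgraph) (F : {set edge G}) : {set G} :=
  \bigcup_(e in F) val e.

Definition edge_degree (G : sgraph) (F : {set edge G}) (v : G) : nat :=
  #|[set e in F | v \in val e]|.

Definition color_class (G : sgraph) n (f : {ffun edge G -> 'I_n}) (c : 'I_n) :
  {set edge G} := [set e | f e == c].

Definition chi_coloring (k : nat) (G : sgraph) n (f : {ffun edge G -> 'I_n}) :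
  bool :=
  [forall c : 'I_n, forall v in ends (color_class f c),
     edge_degree (color_class f c) v == 1 %[mod k]].

(* Colors of 'I_n may be unused, which does not affect the least such n. *)
Definition chi_colorable (k : nat) (G : sgraph) (n : nat) : bool :=
  [exists f : {ffun edge G -> 'I_n}, chi_coloring k f].

(* Giving each edge its own color is a valid coloring. *)
Lemma chi_colorable_ex (k : nat) (G : sgraph) : exists n, chi_colorable k G n.
Proof.
exists #|edge G|; apply/existsP; exists [ffun e => enum_rank e].
apply/forallP=> c; apply/forall_inP=> v /bigcupP[e].
rewrite inE ffunE => /eqP <- ve.
suff -> : edge_degree (color_class [ffun x => enum_rank x] (enum_rank e)) v = 1
  by [].
rewrite -(cards1 e); apply: eq_card => x; rewrite !inE ffunE.
rewrite (inj_eq enum_rank_inj).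
by case: eqVneq => [->|].
Qed.

Definition chromatic_index_mod (k : nat) (G : sgraph) : nat :=
  ex_minn (chi_colorable_ex k G).

(* Main.v *)
Require Import Defs.
From mathcomp Require Import all_boot all_order all_algebra zify ring.

(** Let H be a largest set of edges in which every degree is 0 or 1 modulo k;
    it is the first colour.  Let R be the set of the other edges, X the set of
    the vertices met by H.  Whenever a nonempty part of R could be added to H
    without spoiling the degrees, H would not be largest.  Hence
    - R has no nonempty subset inside X with all degrees divisible by k,
    - no edge has both ends outside X,
    - a vertex of X has fewer than k neighbours outside X, since k of these
      edges could be added at once.
    By [divisible_subgraph] the first fact bounds the number of edges of R
    inside a subset of X by a multiple of its size, and the other two bound
    the number of the remaining edges.  So R is d-degenerate for
    d = 34 k - 18 ([complement_degenerate]), and [degenerate_colour] colours R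
    with 4 d + 2 k - 4 further colours.

    Colouring a d-degenerate graph.  The vertices are ranked so that each has
    at most d edges to vertices of smaller rank, and they are treated by
    increasing rank: at u the edges to later vertices receive their colours.
    These avoid the at most d colours present at u, and each such edge also
    avoids the at most d - 1 colours present at its other end.  This is a list
    colouring problem for the edges of a star, solved by [list_colour]: a few
    colours are used greedily on classes of size 1 modulo k that are as large
    as possible, after which fewer than 2 k edges are left, and these receive
    distinct new colours.

    Divisible subgraphs.  A dense graph has a bipartite subgraph with half of
    its edges, and in it a piece all of whose cuts have more than 8 k - 4 edges
    ([half_cut], [dense_core]).  Remove one edge of that piece.  A subset of the
    rest is the same as an orientation of the rest, where the chosen edges go
    from the first side to the second and the others go back, and the degrees
    modulo k of the subset are determined by the net flow of the orientation
    modulo 2 k at each vertex.  So the removed edge can be completed to a set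
    with all degrees divisible by k as soon as every admissible net flow is
    realised, which is [modular_orientation].

    Modular orientations.  The proof is in the style of Lovasz, Thomassen, Wu
    and Zhang: edges are lifted or deleted and tight cuts are contracted until
    two vertices joined by k - 1 parallel edges remain; these edges alone
    realise every residue of the right parity.  The invariant is the record
    [valid].  Targets are integers that stand for residues modulo 2 k, and all
    vertices but one have nonnegative targets.  The exceptional vertex has a
    negative target and drains its neighbours along directed edges that are
    then deleted, until its own target is 0; from then on it can be split off
    by lifting pairs of edges. *)

Set Implicit Arguments.
Unset Strict Implicit.
Unset Printing Implicit Defensive.

Import Order.TTheory GRing.Theory Num.Theory.

(** * Cuts and net flow of an oriented multigraph *)

Section Flux.
Variables V I : finType.
Implicit Types (E : I -> V * V) (o : I -> bool) (A B : {set V}) (v w : V).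
Local Open Scope ring_scope.

Definition cross E B i : bool := ((E i).1 \in B) (+) ((E i).2 \in B).
Definition cut E B : nat := (\sum_i cross E B i)%N.
(** Edge i goes from (E i).1 to (E i).2 when o i is false and back when o i is
    true; [flux E o B] is then the number of edges leaving B minus the number
    of edges entering B.  Loops contribute nothing to [cut] and [flux], so an
    edge is deleted by turning it into a loop, and the type of edges never
    changes. *)
Definition term E o B i : int :=
  (-1) ^+ o i * (((E i).1 \in B)%:R - ((E i).2 \in B)%:R).
Definition flux E o B : int := \sum_i term E o B i.

Lemma flux_map (phi : V -> V) E o B :
  flux (fun i => (phi (E i).1, phi (E i).2)) o B = flux E o (phi @^-1: B).
Proof. by apply: eq_bigr => i _; rewrite /term /= !inE. Qed.

Lemma cut_map (phi : V -> V) E B :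
  cut (fun i => (phi (E i).1, phi (E i).2)) B = cut E (phi @^-1: B).
Proof. by apply: eq_bigr => i _; rewrite /cross /= !inE. Qed.

Lemma fluxT E o : flux E o setT = 0.
Proof. by apply: big1 => i _; rewrite /term !inE subrr mulr0. Qed.

Lemma fluxU E o A B : [disjoint A & B] -> flux E o (A :|: B) = flux E o A + flux E o B.
Proof.
move=> dAB; rewrite -big_split /=; apply: eq_bigr => i _.
have inU v : (v \in A :|: B)%:R = (v \in A)%:R + (v \in B)%:R :> int.
  rewrite inE; case vA: (v \in A) => //=; last by rewrite add0r.
  by rewrite (disjointFr dAB vA) addr0.
by rewrite /term !inU; ring.
Qed.

Lemma fluxC E o A : flux E o (~: A) = - flux E o A.
Proof.
have := fluxT E o; rewrite -(setUCr A) fluxU ?disjoints_subset ?setCK // => /eqP.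
by rewrite addrC addr_eq0 => /eqP.
Qed.

Lemma flux_sum E o A : flux E o A = \sum_(v in A) flux E o [set v].
Proof.
rewrite exchange_big; apply: eq_bigr => i _.
rewrite /term -mulr_sumr; congr (_ * _); rewrite sumrB.
have S u : \sum_(v in A) (u \in [set v])%:R = (u \in A)%:R :> int.
  case uA: (u \in A).
    rewrite (bigD1 u) //= set11 big1 ?addr0 // => v /andP[_ nvu].
    by rewrite inE eq_sym (negbTE nvu).
  by apply: big1 => v vA; rewrite inE; case: eqP => // uv; rewrite uv vA in uA.
by rewrite !S.
Qed.

Lemma term_parity E o B i : (2 %| (cross E B i)%:R - term E o B i)%Z.
Proof. by rewrite /cross /term; case: (_ \in B); case: (_ \in B); case: (o i). Qed.

Lemma flux_parity E o B : (2 %| (cut E B)%:Z - flux E o B)%Z.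
Proof.
rewrite /cut -natz natr_sum -sumrB; apply: rpred_sum => i _.
exact: term_parity.
Qed.

Lemma flux_eq E o o' B :
  (forall i, cross E B i -> o i = o' i) -> flux E o B = flux E o' B.
Proof.
move=> eqo; apply: eq_bigr => i _; move: (eqo i); rewrite /term /cross.
by case: (_ \in B); case: (_ \in B) => /= h; rewrite ?subrr ?mulr0 // h.
Qed.

Lemma cutU E A B : [disjoint A & B] ->
  (cut E A + cut E B = cut E (A :|: B)
     + (\sum_i (cross E A i && cross E B i)).*2)%N.
Proof.
move=> dAB; rewrite /cut -muln2 big_distrl -!big_split /=; apply: eq_bigr => i _.
rewrite /cross !inE.
have := disjointFr dAB (x := (E i).1); have := disjointFr dAB (x := (E i).2).
by case: ((E i).1 \in A); case: ((E i).2 \in A); case: ((E i).1 \in B);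
  case: ((E i).2 \in B) => //= h1 h2; try (by have := h1 isT); try (by have := h2 isT).
Qed.

End Flux.

(** * Parallel edges, deletion and lifting *)

Lemma subset_of_card (T : finType) (A : {set T}) n :
  n <= #|A| -> exists2 B : {set T}, B \subset A & #|B| = n.
Proof.
move=> nA; exists [set x in take n (enum A)].
  by apply/subsetP=> x; rewrite inE => /mem_take; rewrite mem_enum.
rewrite cardsE (card_uniqP _) ?take_uniq ?enum_uniq // size_take -cardE.
by case: ltngtP nA => // ->.
Qed.

Lemma Posz_sum (T : finType) (P : pred T) (n : T -> nat) :
  Posz (\sum_(i | P i) n i) = (\sum_(i | P i) (n i)%:R)%R.
Proof. by rewrite -natz natr_sum. Qed.

Section Parallel.
Variables V I : finType.
Implicit Types (E : I -> V * V) (o : I -> bool) (A B : {set V}) (v w : V).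
Local Open Scope ring_scope.

Definition joins E a b i : bool := (E i == (a, b)) || (E i == (b, a)).
Definition mult E a b : nat := #|[set i | joins E a b i]|.

Lemma joins_cross E a b i : a != b -> joins E a b i -> cross E [set a] i.
Proof.
move=> ab /orP[] /eqP ei; rewrite /cross ei !inE eqxx //=; last by rewrite eq_sym (negbTE ab).
by rewrite eq_sym (negbTE ab).
Qed.

Lemma term_bound E o B i : `|term E o B i| = cross E B i :> int.
Proof. by rewrite /term /cross; case: (o i); case: (_ \in B); case: (_ \in B). Qed.

Lemma rest_bound E o a b : a != b ->
  `|\sum_(i | ~~ joins E a b i) term E o [set a] i| + (mult E a b)%:Z
     <= (cut E [set a])%:Z.
Proof.
move=> ab; rewrite /cut Posz_sum [leRHS](bigID (joins E a b)) /= [leRHS]addrC; apply: lerD; last first.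
  rewrite /mult -sum1_card Posz_sum [leLHS](eq_bigl (joins E a b)) => [|i]; last by rewrite inE.
  by apply: ler_sum => i /(joins_cross ab) ->.
apply: le_trans (ler_norm_sum _ _ _) _; apply: ler_sum => i _.
by rewrite term_bound natz.
Qed.

Lemma rest_parity E o a b : a != b ->
  (2 %| flux E o [set a] - \sum_(i | ~~ joins E a b i) term E o [set a] i
        - (mult E a b)%:Z)%Z.
Proof.
move=> ab; rewrite /flux (bigID (joins E a b)) /= addrK.
rewrite /mult -sum1_card Posz_sum [\sum_(i in [set _ | _]) _](eq_bigl (joins E a b));
  last by move=> i; rewrite inE.
rewrite -sumrB; apply: rpred_sum => i /(joins_cross ab) ci.
have := term_parity E o [set a] i; rewrite ci -rpredN.
by rewrite opprB.
Qed.

(** The a-b edges together contribute any integer between -mult and mult of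
    the parity of mult, according to the number of them that leave a. *)
Lemma flip_parallel E o a b (T : int) : a != b ->
    (2 %| T - flux E o [set a])%Z ->
    `|T - \sum_(i | ~~ joins E a b i) term E o [set a] i| <= (mult E a b)%:Z ->
  exists2 o' : I -> bool, forall i, ~~ joins E a b i -> o' i = o i
                 & flux E o' [set a] = T.
Proof.
move=> ab; set R := \sum_(i | _) _; set J := [set i | joins E a b i].
have Jflux o' : flux E o' [set a] = \sum_(i in J) term E o' [set a] i
                + \sum_(i | ~~ joins E a b i) term E o' [set a] i.
  rewrite /flux (bigID (mem J)) /=; congr (_ + _).
  by apply: eq_bigl => i; rewrite inE.
have par := rest_parity E o ab.
rewrite -/R Jflux -/R addrK in par.
rewrite Jflux -/R => parT bd.
have [p pq Tp] : exists2 p : nat, (p <= mult E a b)%N & T = R + p%:Z * 2 - (mult E a b)%:Z.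
  have /dvdzP[x xT] : (2 %| T - R + (mult E a b)%:Z)%Z.
    have := rpredD parT par.
    rewrite (_ : T - R + _ = T - (\sum_(i in J) term E o [set a] i + R)
       + (\sum_(i in J) term E o [set a] i - Posz (mult E a b))
        + 2 * (mult E a b)%:Z); last by ring.
    by move=> h; rewrite rpredD // dvdz_mulr.
  by exists `|x|%N; lia.
have [P PJ cP] := subset_of_card pq.
exists (fun i => if i \in J then ((E i).1 == a) (+) (i \in P) else o i) => [i|].
  by rewrite inE => /negbTE ->.
rewrite Jflux Tp addrC -addrA; congr (_ + _).
  apply: eq_bigr => i ji; have h : (i \in J) = false by rewrite inE; apply: negbTE.
  by rewrite /term h.
rewrite (eq_bigr (fun i => (i \in P)%:R * 2 - 1)) => [|i iJ].
  rewrite sumrB -mulr_suml; congr (_ * _ - _).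
    rewrite -Posz_sum -cP; congr Posz.
    rewrite -sum1_card [RHS]big_mkcond [LHS]big_mkcond; apply: eq_bigr => i _ /=.
    case: ifP => iJ; case: ifP => iP //.
    by move/subsetP: PJ => /(_ i iP); rewrite iJ.
  by rewrite sumr_const natz.
rewrite /term iJ; move: iJ; rewrite !inE => /orP[] /eqP ->; rewrite /= !eqxx eq_sym (negbTE ab);
 by case: (i \in P).
Qed.

Lemma cross1P E a i : cross E [set a] i -> exists2 b, b != a & joins E a b i.
Proof.
rewrite /cross /joins !inE; case: (E i) => p q /=.
case: (eqVneq p a) => [->|pa]; case: (eqVneq q a) => [->|qa] //= _.
  by exists q => //; rewrite eqxx.
by exists p => //; rewrite eqxx orbT.
Qed.

Lemma cross_joins E a b i : a != b ->
  cross E [set a] i -> cross E [set b] i -> joins E a b i.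
Proof.
rewrite /cross /joins !inE; case: (E i) => p q ab /=; rewrite !xpair_eqE.
case: (eqVneq p a) => [->|pa]; case: (eqVneq q a) => [->|qa] //=;
  by rewrite ?(negbTE ab) ?addFb ?addbF ?orbF ?andbT.
Qed.

Definition links E : nat := (\sum_x ((E x).1 != (E x).2))%N.

Definition drop_link E j v : I -> V * V := fun x => if x == j then (v, v) else E x.

Lemma drop_link_cut E j v B : (cut E B = cut (drop_link E j v) B + cross E B j)%N.
Proof.
rewrite /cut (bigD1 j) //= [in RHS](bigD1 j) //=.
have -> : cross (drop_link E j v) B j = false by rewrite /cross /drop_link eqxx /= addbb.
rewrite add0n addnC; congr (_ + _)%N; apply: eq_bigr => x xj.
by rewrite /cross /drop_link (negbTE xj).
Qed.

Lemma drop_link_flux E j v o (b : bool) : (exists2 o' : I -> bool,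
  forall x, x != j -> o' x = o x & forall B,
  flux E o' B = flux (drop_link E j v) o B +
    (-1) ^+ b * (((E j).1 \in B)%:R - ((E j).2 \in B)%:R)).
Proof.
exists (fun x => if x == j then b else o x) => [x /negbTE -> //|C].
rewrite /flux (bigD1 j) //= [in RHS](bigD1 j) //=.
have -> : term (drop_link E j v) o C j = 0 by rewrite /term /drop_link eqxx subrr mulr0.
rewrite add0r addrC {2}/term eqxx; congr (_ + _); apply: eq_bigr => x /negbTE xj.
by rewrite /term /drop_link xj.
Qed.

Lemma drop_link_links E j v : (E j).1 != (E j).2 -> (links (drop_link E j v) < links E)%N.
Proof.
move=> nl; rewrite /links (bigD1 j) //= [in ltnRHS](bigD1 j) //= nl.
rewrite {1 2}/drop_link eqxx eqxx.
rewrite (eq_bigr (fun x => nat_of_bool ((E x).1 != (E x).2))) //.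
by move=> x xj; rewrite /drop_link (negbTE xj).
Qed.

(** Lifting at f: the path u - f - v formed by the edges i and j is replaced by
    the single edge u - v, stored under i, and j becomes a loop. *)
Definition reroute E i j f v : I -> V * V := fun x =>
  if x == i then (if (E i).1 == f then (v, (E i).2) else ((E i).1, v))
  else if x == j then (v, v) else E x.

Lemma reroute_cut E i j f u v B : i != j -> u != f ->
    joins E f u i -> joins E f v j ->
  (cut E B = cut (reroute E i j f v) B
     + (if ((u \in B) == (v \in B)) && ((u \in B) != (f \in B)) then 2 else 0))%N.
Proof.
move=> ij uf Ji Jj; rewrite /cut (bigD1 i) //= [in RHS](bigD1 i) //=.
rewrite (bigD1 j) 1?eq_sym //= [in RHS](bigD1 j) 1?eq_sym //=.
rewrite [in RHS](eq_bigr (fun x => nat_of_bool (cross E B x))); last first.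
  by move=> x /andP[xi xj]; rewrite /cross /reroute (negbTE xi) (negbTE xj).
have -> : cross (reroute E i j f v) B j = false.
  by rewrite /cross /reroute eq_sym (negbTE ij) eqxx /= addbb.
move: Ji Jj; rewrite /joins /cross /reroute eqxx => /orP[] /eqP -> /orP[] /eqP ->;
  rewrite /= ?eqxx ?(negbTE uf) /=;
  by case: (u \in B); case: (v \in B); case: (f \in B) => /=; lia.
Qed.

(** An orientation of the edge u - v is pulled back to the path through f,
    which leaves the net flow at f unchanged. *)
Lemma reroute_flux E i j f u v o : i != j -> u != f -> v != f ->
    joins E f u i -> joins E f v j ->
  exists2 o' : I -> bool, forall x, x != j -> o' x = o x
  & forall B, flux E o' B = flux (reroute E i j f v) o B.
Proof.
move=> ij uf vf Ji Jj.
pose o' x := if x == j then o i (+) ((E i).1 == f) (+) ((E j).1 != f) else o x.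
exists o' => [x /negbTE xj|B]; first by rewrite /o' xj.
rewrite /flux (bigD1 i) //= [in RHS](bigD1 i) //=.
rewrite (bigD1 j) 1?eq_sym //= [in RHS](bigD1 j) 1?eq_sym //=.
rewrite [in RHS](eq_bigr (term E o' B)); last first.
  by move=> x /andP[xi xj]; rewrite /term /o' /reroute (negbTE xi) (negbTE xj).
have -> : term (reroute E i j f v) o B j = 0.
  by rewrite /term /reroute eq_sym (negbTE ij) eqxx /= subrr mulr0.
rewrite add0r addrA; congr (_ + _).
move: Ji Jj; rewrite /joins /term /reroute /o' !eqxx (negbTE ij);
move=> /orP[] /eqP -> /orP[] /eqP ->; rewrite /= ?eqxx ?(negbTE uf) ?(negbTE vf) /=;
by case: (o i); rewrite /=; ring.
Qed.

Lemma reroute_links E i j f u v : i != j -> u != f -> v != f -> u != v ->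
    joins E f u i -> joins E f v j ->
  (links (reroute E i j f v) < links E)%N.
Proof.
move=> ij uf vf uv Ji Jj; rewrite /links (bigD1 i) //= [in ltnRHS](bigD1 i) //=.
rewrite (bigD1 j) 1?eq_sym //= [in ltnRHS](bigD1 j) 1?eq_sym //=.
rewrite (eq_bigr (fun x => nat_of_bool ((E x).1 != (E x).2))); last first.
  by move=> x /andP[xi xj]; rewrite /reroute (negbTE xi) (negbTE xj).
move: Ji Jj; rewrite /joins /reroute !eqxx [j == i]eq_sym (negbTE ij).
move=> /orP[] /eqP -> /orP[] /eqP ->; rewrite /= ?eqxx ?(negbTE uf) /=;
  rewrite ?uv ?vf ?uf 1?[v == u]eq_sym ?uv 1?[f == u]eq_sym ?uf 1?[f == v]eq_sym ?vf ?eqxx; lia.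
Qed.

End Parallel.

(** * Orientations with prescribed net flow modulo 2k *)

Section Orient.
Variables (k : nat) (V I : finType).
Hypothesis k_gt1 : 1 < k.
Implicit Types (E : I -> V * V) (o : I -> bool) (A B W F : {set V}) (v w : V).
Implicit Types (t : V -> int) (rho : V -> nat) (s : option V).
Local Open Scope ring_scope.

(** These bounds satisfy three relations.
    - c_set = c_normal + 2k - 1: a contracted set of nonfree vertices can serve
      as a normal vertex, whatever its target in [0, 2k).
    - c_normal = c_special + 2k: a normal vertex can be turned into the special
      one by subtracting 2k from its target.
    - c_special + c_normal = c_set + 2k - 2: the last two vertices are joined by
      at least k - 1 parallel edges. *)
Let c_special : nat := (4 * k - 3)%N.
Let c_normal : nat := (6 * k - 3)%N.
Let c_set : nat := (8 * k - 4)%N.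
Let m : int := (2 * k)%N%:Z.

Let c_set_gt0 : (0 < c_set)%N. Proof. by rewrite /c_set; lia. Qed.

(** Lower bound asked of the cut around B.  Free vertices do not count: with
    only them in B nothing is asked, with one nonfree vertex y the bound is
    rho y, and with several it is c_set. *)
Definition need F rho B : nat :=
  if (1 < #|B :\: F|)%N then c_set else (\max_(y in B :\: F) rho y)%N.

(** The invariant of the induction.  The edges inside W may still be turned,
    all others keep the orientation o.  The integer t v stands for the
    prescribed net flow out of v modulo 2k.
    A free vertex, in F, has target 0 and can be split off by lifting pairs of
    edges.  A normal vertex has a nonnegative target and degree at least
    c_normal plus this target, so that directing an edge out of it and deleting
    this edge costs as much degree as it lowers the target.  There is at most
    one special vertex, named by s; its target is nonpositive, and in the same
    way it can afford incoming edges.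
    The field v_out bounds the number of edges that leave W.  It is what a
    contraction leaves to the inside of a tight set, and it guarantees that
    enough of the degree demanded by v_cut comes from edges inside W. *)
Record valid W F E o t rho s : Prop := Valid {
  v_free_sub : F \subset W;
  v_core : W :\: F != set0;
  v_free : forall f, f \in F -> t f = 0;
  v_normal : forall y, y \in W :\: F -> Some y != s ->
    0 <= t y /\ c_normal%:Z + t y <= (rho y)%:Z;
  v_special : forall y, y \in W :\: F -> Some y = s ->
    t y <= 0 /\ c_special%:Z - t y <= (rho y)%:Z;
  v_rho : forall y, y \in W :\: F -> (rho y <= c_set)%N;
  v_parity : forall v, v \in W -> (2 %| (cut E [set v])%:Z - t v)%Z;
  v_sum : (m %| flux E o (~: W) + \sum_(v in W) t v)%Z;
  v_out : (cut E W <= (need F rho W).+1)%N;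
  v_cut : forall B, B \proper W -> (need F rho B <= cut E B)%N }.

Definition inside E W i : bool := ((E i).1 \in W) && ((E i).2 \in W).

Definition solvable W E o t : Prop :=
  exists2 o' : I -> bool, forall i, ~~ inside E W i -> o' i = o i
  & forall v, v \in W -> (m %| flux E o' [set v] - t v)%Z.

Lemma m_dvd2 x : (m %| x)%Z -> (2 %| x)%Z.
Proof. by apply: dvdz_trans; rewrite /m PoszM dvdz_mulr. Qed.

Lemma need_eq F F' rho rho' B B' : B :\: F = B' :\: F' ->
  {in B :\: F, rho =1 rho'} -> need F rho B = need F' rho' B'.
Proof.
move=> eN er; rewrite /need -eN; case: ifP => // _.
by apply: eq_bigr => y /er.
Qed.

Lemma need1 F rho B y : B :\: F = [set y] -> need F rho B = rho y.
Proof. by move=> e; rewrite /need e cards1 /= big_set1. Qed.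

Lemma need2 F rho B : (1 < #|B :\: F|)%N -> need F rho B = c_set.
Proof. by rewrite /need => ->. Qed.

Lemma need0 F rho B : B \subset F -> need F rho B = 0.
Proof. by rewrite -setD_eq0 /need => /eqP ->; rewrite cards0 big_set0. Qed.

Lemma cut_parity_sum E A :
  (2 %| (cut E A)%:Z - \sum_(v in A) (cut E [set v])%:Z)%Z.
Proof.
pose o : I -> bool := fun=> false.
have := flux_parity E o A; rewrite flux_sum => h1.
have h2 : (2 %| \sum_(v in A) ((cut E [set v])%:Z - flux E o [set v]))%Z.
  by apply: rpred_sum => v _; apply: flux_parity.
by have := rpredB h1 h2; rewrite sumrB opprB addrA subrK.
Qed.

Lemma parity_set W F E o t rho s A : valid W F E o t rho s -> A \subset W ->
  (2 %| (cut E A)%:Z - \sum_(v in A) t v)%Z.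
Proof.
move=> vI /subsetP AW; have h1 := cut_parity_sum E A.
have h2 : (2 %| \sum_(v in A) ((cut E [set v])%:Z - t v))%Z.
  by apply: rpred_sum => v /AW; apply: (v_parity vI).
by have := rpredD h1 h2; rewrite sumrB addrA subrK.
Qed.

(** Contraction of A to its member a: the edges inside A become loops, and the
    other vertices of A become isolated and leave the vertex set. *)
Definition merge A a v : V := if v \in A then a else v.
Definition contract A a E i : V * V := (merge A a (E i).1, merge A a (E i).2).

Lemma merge_preim A a B : a \in A ->
  merge A a @^-1: B = if a \in B then B :|: A else B :\: A.
Proof.
move=> aA; apply/setP=> v; rewrite inE /merge.
case: ifP => vA; case: ifP => aB; rewrite !inE ?vA ?orbT ?orbF ?andbF ?andbT //.
Qed.

Lemma cut_contract A a E B : a \in A ->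
  cut (contract A a E) B = cut E (if a \in B then B :|: A else B :\: A).
Proof. by move=> aA; rewrite cut_map merge_preim. Qed.

Lemma flux_contract A a E o B : a \in A ->
  flux (contract A a E) o B = flux E o (if a \in B then B :|: A else B :\: A).
Proof. by move=> aA; rewrite flux_map merge_preim. Qed.

(** A solution of the contracted graph orients every edge that is not inside A
    and gives A the right net flow; the edges inside A are then oriented with
    all the others fixed. *)
Lemma glue W E o t t1 A a : A \subset W -> a \in A ->
    {in W :\: A, t1 =1 t} ->
    solvable (a |: (W :\: A)) (contract A a E) o t1 ->
    (forall o1, (m %| flux E o1 A - t1 a)%Z -> solvable A E o1 t) ->
  solvable W E o t.
Proof.
move=> /subsetP AW aA et [o1 fix1 sol1] inA.
have [|o2 fix2 sol2] := inA o1.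
  have := sol1 a; rewrite setU11 => /(_ isT).
  by rewrite flux_contract // inE eqxx (setUidPr _) // sub1set.
exists o2 => [i|v vW].
  move=> niW; rewrite fix2; last first.
    by apply: contra niW => /andP[p q]; rewrite /inside !AW.
  apply: fix1; apply: contra niW; rewrite /inside /contract /= /merge.
  case/andP=> p q; apply/andP; split.
    by move: p; case: ifP => [/AW //|pA]; rewrite !inE pA => /orP[/eqP pa|//]; rewrite pa aA in pA.
  by move: q; case: ifP => [/AW //|pA]; rewrite !inE pA => /orP[/eqP pa|//]; rewrite pa aA in pA.
have [vA|vA] := boolP (v \in A); first exact: sol2.
have vWA : v \in W :\: A by rewrite inE vA.
rewrite (@flux_eq _ _ E o2 o1) => [|i]; last first.
  rewrite /cross => ci; apply: fix2; apply: contraL ci => /andP[p q].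
  by rewrite !inE; do 2![case: eqP => [e|_]; first by rewrite -e ?p ?q in vA].
have := sol1 v; rewrite !inE vA vW orbT => /(_ isT).
rewrite flux_contract // inE; case: eqP => [av|_]; first by rewrite -av aA in vA.
by rewrite (setDidPl _) ?et // disjoints1.
Qed.

(** If A has a single nonfree vertex, this vertex keeps its role.  Otherwise A
    becomes a normal vertex, with the sum of the targets reduced to [0, 2k),
    and absorbs the special vertex when it contains it. *)
Lemma contract_valid W F E o t rho s A a (t1 := fun v => if v == a then
      if (1 < #|A :\: F|)%N then ((\sum_(v in A) t v) %% m)%Z else t a else t v) 
    (rho1 := fun v => if v == a then need F rho A else rho v) : 
  valid W F E o t rho s -> A \proper W -> a \in A :\: F ->
  exists s1, valid (a |: (W :\: A)) (F :\: A) (contract A a E) o t1 rho1 s1.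
Proof.
move=> vI pAW /setDP[aA aF]; have AW := proper_sub pAW.
have aW : a \in W by apply: (subsetP AW).
set W1 := a |: (W :\: A); set F1 := F :\: A.
pose pre B := if a \in B then B :|: A else B :\: A.
have W1A v : v \in W1 -> v \in A -> v = a.
  by rewrite !inE => /orP[/eqP //|/andP[/negP]].
have W1W : W1 \subset W.
  by rewrite subUset sub1set aW subsetDl.
have needP B : B \subset W1 -> need F1 rho1 B = need F rho (pre B).
  move=> /subsetP BW1; rewrite /pre; case: ifP => aB; last first.
    have BA v : v \in B -> v \notin A.
      by move=> vB; apply/negP=> vA; move: aB; rewrite -(W1A v) ?vB //; apply: BW1.
    apply: need_eq => [|y].
      apply/setP=> v; rewrite !inE; case vB: (v \in B); last by rewrite !andbF.
      by rewrite BA.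
    by rewrite inE => /andP[_ yB]; rewrite /rho1; case: eqP => // ya; rewrite ya aB in yB.
  have [/exists_inP[z zB /andP[zA zF]]|nz] :=
      boolP [exists z in B, (z \notin A) && (z \notin F)].
    have az : a != z by apply: contraNneq zA => <-.
    have two C F' : a \in C :\: F' -> z \in C :\: F' -> (1 < #|C :\: F'|)%N.
      move=> aC zC; rewrite (cardD1 a) aC (cardD1 z).
      by rewrite inE /= eq_sym az zC.
    by rewrite !need2 // two // !inE ?aA ?aB ?zA ?zB ?aF ?zF ?orbT.
  have eB : B :\: F1 = [set a].
    apply/setP=> v; rewrite !inE; apply/andP/eqP => [[vF vB]|->]; last by rewrite aA aB.
    have [vA|vA] := boolP (v \in A); first by rewrite (W1A v) // BW1.
    case/exists_inP: nz; exists v => //; rewrite vA /=.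
    by move: vF; rewrite vA.
  rewrite (need1 rho1 eB) /rho1 eqxx; apply: need_eq => // .
  apply/setP=> v; rewrite !inE; case vF: (v \in F) => //=.
  case vA: (v \in A); first by rewrite orbT.
  rewrite orbF; apply/esym/negbTE/negP => vB.
  by case/exists_inP: nz; exists v => //; rewrite vA vF.
have pre_proper B : B \proper W1 -> pre B \proper W.
  case/properP=> /subsetP BW1 [z zW1 zB]; apply/properP; split.
    rewrite /pre; case: ifP => _; first rewrite subUset AW andbT.
      by apply/subsetP=> v /BW1; apply/subsetP.
    by apply/subsetP=> v /setDP[/BW1 + _]; apply/subsetP.
  move: zW1; rewrite !inE => /orP[/eqP za|/andP[zA zW]].
    exists a => //; rewrite /pre -za (negbTE zB) !inE za aA //.
  by exists z => //; rewrite /pre; case: ifP => _; rewrite !inE ?(negbTE zB) ?(negbTE zA).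
have cutP B : cut (contract A a E) B = cut E (pre B) by rewrite cut_contract.
have preW : pre W1 = W.
  rewrite /pre setU11; apply/setP=> v; rewrite !inE.
  have := subsetP AW v; case: (v \in A) => /= [-> //|_]; first by rewrite orbT.
  by rewrite orbF; case: eqP => // ->.
have tA : (m %| t1 a - \sum_(v in A) t v)%Z.
  rewrite /t1 eqxx; case: ifP => [_|cA].
    by rewrite -eqz_mod_dvd modz_mod.
  rewrite (bigD1 a) //= big1 ?addr0 ?subrr ?dvdz0 // => v /andP[vA va].
  apply: (v_free vI); apply: contraFT cA => vF.
  by rewrite (cardD1 a) inE aA aF (cardD1 v) !inE va vA vF.
have coreP y : y \in W1 :\: F1 -> y = a \/ [/\ y != a, y \notin A & y \in W :\: F].
  rewrite !inE; case: (eqVneq y a) => [-> _|ya /=]; first by left.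
  by case: (y \in A) => //= /andP[-> ->]; right.
have aC : a \in W :\: F by rewrite inE aF.
have tE y : y != a -> t1 y = t y by rewrite /t1 => /negbTE ->.
have rhoE y : y != a -> rho1 y = rho y by rewrite /rho1 => /negbTE ->.
have m_gt0 : 0 < m by rewrite /m; lia.
have mE : m = (2 * k)%N%:Z by [].
have rho1a : (1 < #|A :\: F|)%N \/ A :\: F = [set a].
  have [c|] := leqP #|A :\: F| 1; [right | by left].
  apply/eqP; rewrite eq_sym eqEcard sub1set cards1 c andbT.
  by rewrite inE aF.
exists (if s is Some x then if (1 < #|A :\: F|)%N && (x \in A) then None else s else s).
split.
- by apply/subsetP=> f; rewrite !inE => /andP[-> /(subsetP (v_free_sub vI)) ->]; rewrite orbT.
- by apply/set0Pn; exists a; rewrite !inE aA eqxx.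
- move=> f /setDP[fF fA]; rewrite tE ?(v_free vI) //.
  by apply: contraNneq fA => ->.
- move=> y /coreP[->|[ya yA yC]] ys.
    rewrite /t1 /rho1 eqxx; case: rho1a => [c|c].
      rewrite c need2 // modz_ge0 ?lt0r_neq0 //; split => //.
      by have := ltz_pmod (\sum_(v in A) t v) m_gt0; rewrite {2}mE /c_normal /c_set; lia.
    rewrite c cards1 /= (need1 _ c); apply: (v_normal vI) => //.
    by move: ys; rewrite c cards1 /=; case: s {vI}.
  rewrite tE // rhoE //; apply: (v_normal vI) => //.
  move: ys; case: s {vI} => // x; case: ifP => // /andP[_ xA] _.
  by apply: contraNneq yA => -[->].
- move=> y /coreP[->|[ya yA yC]] ys.
    rewrite /t1 /rho1 eqxx; case: rho1a => [c|c].
      by move: ys; case: s {vI} => // x; rewrite c /=; case: ifP => // + [ax]; rewrite -ax aA.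
    rewrite c cards1 /= (need1 _ c); apply: (v_special vI) => //.
    by move: ys; rewrite c cards1 /=; case: s {vI}.
  rewrite tE // rhoE //; apply: (v_special vI) => //.
  by move: ys; case: s {vI} => // x; case: ifP.
- move=> y /coreP[->|[ya yA yC]]; last by rewrite rhoE // (v_rho vI).
  rewrite /rho1 eqxx; case: rho1a => c; first by rewrite need2.
  by rewrite (need1 _ c) (v_rho vI).
- move=> v vW1; rewrite cut_contract // inE.
  case: (eqVneq a v) => [av|av].
    rewrite -av (setUidPr _) ?sub1set //.
    have := rpredB (parity_set vI AW) (m_dvd2 tA).
    by rewrite (_ : _ - _ - _ = Posz (cut E A) - t1 a) //; ring.
  rewrite (setDidPl _) ?tE 1?eq_sym //.
    by apply: (v_parity vI); apply: (subsetP W1W).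
  by rewrite disjoints1; move: vW1; rewrite !inE eq_sym (negbTE av) => /andP[].
- rewrite flux_contract // inE setU11 /=.
  rewrite (_ : ~: W1 :\: A = ~: W); last first.
    apply/setP=> v; rewrite !inE; have := subsetP AW v.
    case: (v \in A) => /= [-> //|_]; case: eqP => //= ->; by rewrite aW.
  rewrite big_setU1 ?inE ?aA //= (eq_bigr t) => [|v /setDP[_ vA]]; last first.
    by rewrite tE //; apply: contraNneq vA => ->.
  have := rpredD (v_sum vI) tA; rewrite (big_setID A) /= (setIidPr AW).
  by rewrite (_ : _ + _ + _ = flux E o (~: W) + (t1 a + \sum_(i in W :\: A) t i)) //; ring.
- by rewrite needP // cutP preW (v_out vI).
- move=> B BW1; rewrite needP ?proper_sub // cutP (v_cut vI) //.
  exact: pre_proper.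
Qed.

Lemma inside_valid W F E o t rho s A o1 :
    valid W F E o t rho s -> A \proper W -> A :\: F != set0 ->
    (cut E A <= (need F rho A).+1)%N ->
    (m %| flux E o1 A - \sum_(v in A) t v)%Z ->
  valid A (F :&: A) E o1 t rho s.
Proof.
move=> vI pAW nA cA dA; have AW := proper_sub pAW.
have subC : A :\: (F :&: A) = A :\: F.
  by apply/setP=> v; rewrite !inE; case: (v \in A); rewrite ?andbF ?andbT.
have toC y : y \in A :\: F -> y \in W :\: F by apply/subsetP/setSD.
have needE B : B \subset A -> need (F :&: A) rho B = need F rho B.
  move=> /subsetP BA; apply: need_eq => //; apply/setP=> v; rewrite !inE.
  by case vB: (v \in B); rewrite ?andbF // BA // !andbT.
split; rewrite ?subsetIr ?subC //.
- by move=> f /setIP[fF _]; apply: (v_free vI).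
- by move=> y /toC; apply: (v_normal vI).
- by move=> y /toC; apply: (v_special vI).
- by move=> y /toC; apply: (v_rho vI).
- by move=> v /(subsetP AW); apply: (v_parity vI).
- by rewrite fluxC -[X in _ + X]opprK -opprD rpredN.
- by rewrite needE.
- move=> B pB; rewrite needE ?proper_sub // (v_cut vI) //.
  exact: proper_trans pB pAW.
Qed.

Definition solves_smaller n : Prop := forall W F E o t rho s,
  (#|W| < n)%N -> valid W F E o t rho s -> solvable W E o t.

(** Tightness of B is what makes [v_out] hold for the instance inside B, while
    contraction preserves all cuts; so both halves are smaller instances. *)
Lemma tight_reduce W F E o t rho s B :
    solves_smaller #|W| -> valid W F E o t rho s ->
    B \proper W -> (1 < #|B|)%N -> (0 < need F rho B)%N ->
    (cut E B <= (need F rho B).+1)%N ->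
  solvable W E o t.
Proof.
move=> IH vI pB B1 nB cB; have BW := proper_sub pB.
have /set0Pn[a aBF] : B :\: F != set0.
  by apply: contraTneq nB => BF; rewrite /need BF cards0 big_set0.
have aB : a \in B by case/setDP: aBF.
have [s1 v1] := contract_valid vI pB aBF.
set t1 := fun _ => _ in v1.
apply: (glue (t1 := t1) BW aB).
- by move=> v /setDP[_ vB]; rewrite /t1; case: eqP => // va; rewrite va aB in vB.
- apply: IH v1; rewrite cardsU1 !inE aB /= cardsD (setIidPr BW).
  by have := subset_leq_card BW; lia.
move=> o1 d1; apply: (IH _ (F :&: B) _ _ _ rho s (proper_card pB)).
apply: (inside_valid vI) => //; first by apply/set0Pn; exists a.
have := v_sum v1; have := v_sum vI.
rewrite flux_contract // !inE eqxx /=.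
rewrite (_ : ~: (a |: (W :\: B)) :\: B = ~: W); last first.
  apply/setP=> v; rewrite !inE; have := subsetP BW v.
  have [vB /(_ isT) ->|vB _] := boolP (v \in B); first by [].
  by rewrite /=; case: eqP => //= va; rewrite va aB in vB.
rewrite big_setU1 ?inE ?aB //= (big_setID B) /= (setIidPr BW).
rewrite [\sum_(i in W :\: B) t1 i](eq_bigr t) => [h1 h2|v /setDP[_ vB]]; last first.
  by rewrite /t1; case: eqP => // va; rewrite va aB in vB.
have := rpredD (rpredB h2 h1) d1.
by rewrite (_ : _ - _ + _ = flux E o1 B - \sum_(i in B) t i) //; ring.
Qed.

Lemma pair_solve E o t a b T : a != b ->
    (2 %| T - flux E o [set a])%Z ->
    `|T - \sum_(i | ~~ joins E a b i) term E o [set a] i| <= (mult E a b)%:Z ->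
    (m %| T - t a)%Z -> (m %| flux E o [set a; b] - (t a + t b))%Z ->
  solvable [set a; b] E o t.
Proof.
move=> ab par bd ta tab; have [o' fix' fa] := flip_parallel ab par bd.
have fab : flux E o' [set a; b] = flux E o [set a; b].
  apply: flux_eq => i; rewrite /cross => ci; apply: fix'; apply: contraL ci.
  by rewrite /joins => /orP[] /eqP ->; rewrite /= !inE !eqxx orbT.
exists o' => [i ni|v].
  apply: fix'; apply: contra ni.
  by rewrite /joins /inside => /orP[] /eqP ->; rewrite /= !inE !eqxx orbT.
rewrite !inE => /orP[] /eqP ->; first by rewrite fa.
move: tab; rewrite -fab fluxU ?disjoints1 ?inE // fa => tab.
have := rpredB tab ta.
by rewrite (_ : _ - _ - _ = flux E o' [set b] - t b) //; ring.
Qed.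

(** With at least k - 1 parallel edges between y and w, the net flow out of y
    takes at least k consecutive values of the same parity, hence every residue
    modulo 2k of this parity. *)
Lemma base_solve W F E o t rho s y w : valid W F E o t rho s -> y != w ->
  W = [set y; w] -> (k.-1 <= mult E y w)%N -> solvable W E o t.
Proof.
move=> vI yw eW mk; rewrite eW.
have yW : y \in W by rewrite eW !inE eqxx.
set R := \sum_(i | ~~ joins E y w i) term E o [set y] i.
set q := (mult E y w)%:Z.
have h1 := rest_parity E o yw; rewrite -/R -/q in h1.
have h2 := v_parity vI yW; have h3 := flux_parity E o [set y].
have h4 : (2 %| t y - R + q)%Z.
  rewrite (_ : t y - R + q = (flux E o [set y] - R - q)
    + ((cut E [set y])%:Z - flux E o [set y]) - ((cut E [set y])%:Z - t y) + 2 * q).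
    by apply: rpredD (rpredB (rpredD h1 h3) h2) _; rewrite dvdz_mulr.
  by ring.
have m_gt0 : 0 < m by rewrite /m; lia.
(* R - q + z is the value in the attainable range [R - q, R + q] that is
   congruent to the target. *)
pose z := ((t y - R + q) %% m)%Z.
have zE : t y - R + q = ((t y - R + q) %/ m)%Z * m + z by apply: divz_eq.
have z0 : 0 <= z by rewrite /z modz_ge0 // lt0r_neq0.
have zm : z < m by apply: ltz_pmod.
have z2 : (2 %| z)%Z.
  have -> : z = (t y - R + q) - ((t y - R + q) %/ m)%Z * m by rewrite {1}zE; ring.
  by apply: (rpredB h4); rewrite m_dvd2 // dvdz_mull.
apply: (pair_solve (T := R - q + z)) => //.
- rewrite (_ : _ - _ = z - (flux E o [set y] - R - q) - 2 * q); last by ring.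
  by apply: rpredB (rpredB z2 h1) _; rewrite dvdz_mulr.
- rewrite -/R -/q; have /dvdzP[x ex] := z2.
  by move: zm mk; rewrite ex /q /m; lia.
- rewrite (_ : _ - _ = - (((t y - R + q) %/ m)%Z * m)); last first.
    have := zE; set d := (_ %/ _)%Z; lia.
  by rewrite rpredN dvdz_mull.
- have := v_sum vI; rewrite eW fluxC big_setU1 ?inE //= big_set1 -rpredN.
  by rewrite opprD opprK.
Qed.

(** If at least half of the edges at a free vertex f go to v, these edges can
    balance f whatever the other edges at f do; so f may be merged into v. *)
Lemma merge_free W F E o t rho s f v :
    solves_smaller #|W| -> valid W F E o t rho s ->
    f \in F -> v \in W -> v != f ->
    (cut E [set f] <= (mult E f v).*2)%N ->
  solvable W E o t.
Proof.
move=> IH vI fF vW vf cf; have fW : f \in W := subsetP (v_free_sub vI) _ fF.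
have tf := v_free vI fF.
have vA : v \in [set f; v] by rewrite !inE eqxx orbT.
have AW : [set f; v] \subset W by rewrite subUset !sub1set fW.
have eW1 : v |: (W :\: [set f; v]) = W :\ f.
  by apply/setP=> x; rewrite !inE; case: (eqVneq x v) => [->|] /=; rewrite ?vf ?vW ?orbF ?andbT.
apply: (glue (t1 := t) AW vA) => //.
  apply: (IH _ (F :\ f) _ _ _ rho s).
    by rewrite eW1 (cardsD1 f W) fW.
  rewrite eW1; pose pre B := if v \in B then f |: B else B.
  have cutP B : B \subset W :\ f -> cut (contract [set f; v] v E) B = cut E (pre B).
    move=> /subsetP BW; rewrite cut_contract //; congr cut; apply/setP=> x.
    have := BW x; rewrite /pre; case: ifP => vB; rewrite !inE; case: (eqVneq x v) => [->|xv];
     rewrite ?vB ?orbT ?orbF //=; first by case: (x == f); case: (x \in B).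
    by have [xB /(_ isT)/andP[-> _]|xB _] := boolP (x \in B); rewrite ?andbF.
  have coreE B : B \subset W :\ f -> B :\: (F :\ f) = pre B :\: F.
    move=> /subsetP BW; apply/setP=> x; have := BW x; rewrite /pre.
    case: ifP => vB; rewrite !inE; case: (eqVneq x f) => [->|xf]; rewrite ?fF //=.
      by case: (f \in B) => // /(_ isT).
    by case: (f \in B) => // /(_ isT).
  have needE B : B \subset W :\ f -> need (F :\ f) rho B = need F rho (pre B).
    by move=> BW; apply: need_eq => //; apply: coreE.
  have preW : pre (W :\ f) = W.
    by rewrite /pre !inE vf vW /= setD1K.
  have preP B : B \proper W :\ f -> pre B \proper W.
    case/properP=> /subsetP BW [z /setD1P[zf zW] zB]; apply/properP; split.
      have BW' : B \subset W by apply/subsetP=> x /BW /setD1P[].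
      by rewrite /pre; case: ifP => // _; rewrite subUset sub1set fW.
    by exists z => //; rewrite /pre; case: ifP; rewrite // !inE negb_or zf.
  have NE : (W :\ f) :\: (F :\ f) = W :\: F.
    by rewrite coreE // preW.
  have DW x : x \in W :\ f -> x \in W by case/setD1P.
  split; rewrite ?NE.
  - exact: setSD (v_free_sub vI).
  - exact: v_core vI.
  - by move=> x /setD1P[_]; apply: v_free vI x.
  - exact: v_normal vI.
  - exact: v_special vI.
  - exact: v_rho vI.
  - move=> x xW; have [xf xW'] := setD1P xW.
    rewrite cutP ?sub1set // /pre inE; case: eqP => [vx|_]; last by apply: (v_parity vI).
    rewrite -vx; have := parity_set vI AW.
    by rewrite big_setU1 ?inE 1?eq_sym //= tf add0r big_set1.
  - rewrite flux_contract // !inE vf vW /=.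
    have := v_sum vI; rewrite (big_setD1 f) //= tf add0r.
    congr (_ %| flux E o _ + _)%Z; apply/setP=> x; rewrite !inE.
    case: (eqVneq x f) => [->|xf] /=; first by rewrite fW.
    by case: (eqVneq x v) => [->|//]; rewrite vW.
  - by rewrite needE // cutP // preW (v_out vI).
  - by move=> B pB; rewrite needE ?cutP ?proper_sub // (v_cut vI) // preP.
move=> o1 d1; have fv : f != v by rewrite eq_sym.
have h1 := flux_parity E o1 [set f]; have h2 := v_parity vI fW.
apply: (pair_solve (T := 0)) => //.
- rewrite tf subr0 in h2; have := rpredB h1 h2.
  by rewrite (_ : _ - _ - _ = 0 - flux E o1 [set f]) //; ring.
- have := rest_bound E o1 fv; set R := \sum_(i | _) _.
  by move: cf; lia.
- by rewrite tf subrr dvdz0.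
- by rewrite tf add0r.
Qed.

Definition no_tight W F E rho : Prop := forall B, B \proper W ->
  (1 < #|B|)%N -> (0 < need F rho B)%N -> (need F rho B + 2 <= cut E B)%N.

(** Lifting u - f - v lowers by 2 exactly the cuts that separate f from both u
    and v.  Such a cut is around f alone, where nothing is asked, or around a
    set of at least two vertices, where there is room because no such set is
    tight. *)
Lemma lift_valid W F E o t rho s i j f u v :
    valid W F E o t rho s -> no_tight W F E rho -> f \in F -> v \in W ->
    i != j -> u != f -> v != f -> u != v ->
    joins E f u i -> joins E f v j ->
  valid W F (reroute E i j f v) o t rho s.
Proof.
move=> vI nt fF vW ij uf vf uv Ji Jj.
have fW : f \in W := subsetP (v_free_sub vI) _ fF.
have cutE B := reroute_cut B ij uf Ji Jj.
split; try by case: vI.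
- move=> x xW; have := v_parity vI xW; rewrite cutE; case: ifP => _; last by rewrite addn0.
  move=> h; have := rpredB h (dvdzz 2); rewrite PoszD.
  by rewrite (_ : _ - _ - _ = (cut (reroute E i j f v) [set x])%:Z - t x) //; ring.
- have := v_sum vI; congr (_ %| _ + _)%Z; apply: eq_bigr => x _.
  rewrite /term /reroute; case: eqP => [->|_]; last case: eqP => [->|//].
    by move: Ji; rewrite /joins => /orP[] /eqP ->; rewrite /= ?eqxx ?(negbTE uf) !inE vW fW.
  by move: Jj; rewrite /joins => /orP[] /eqP ->; rewrite /= !inE vW fW.
- have := v_out vI; rewrite cutE vW fW.
  by case: (u \in W); rewrite /= addn0.
- move=> B pB; have := v_cut vI pB; rewrite cutE.
  case: ifP => [/andP[/eqP uvB ufB]|_]; last by rewrite addn0.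
  move=> _; have [nB|] := posnP (need F rho B); first by rewrite nB.
  move=> nB; rewrite -(leq_add2r 2); apply: leq_trans (nt _ pB _ nB) _; last first.
    by rewrite cutE uvB -uvB eqxx ufB.
  have [fB|fB] := boolP (f \in B); last first.
    have uB : u \in B by move: ufB; rewrite (negbTE fB); case: (u \in B).
    by rewrite (cardsD1 u) uB (cardsD1 v) !inE eq_sym uv -uvB uB.
  have /set0Pn[x /setDP[xB xF]] : B :\: F != set0.
    by rewrite setD_eq0; apply: contraTN nB => /need0 ->.
  rewrite (cardsD1 f) fB (cardsD1 x) !inE xB.
  by have -> : x != f by apply: contraNneq xF => ->.
Qed.

Lemma lift_solve W E o t i j f u v :
    f \in W -> v \in W ->
    i != j -> u != f -> v != f ->
    joins E f u i -> joins E f v j ->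
  solvable W (reroute E i j f v) o t -> solvable W E o t.
Proof.
move=> fW vW ij uf vf Ji Jj [o1 fix1 sol1].
have [o2 fix2 flux2] := reroute_flux o1 ij uf vf Ji Jj.
exists o2 => [x nx|w wW]; last by rewrite flux2; apply: sol1.
have xj : x != j.
  apply: contraNneq nx => ->; move: Jj; rewrite /joins /inside => /orP[] /eqP ->;
  by rewrite /= fW vW.
rewrite fix2 //; apply: fix1; apply: contra nx.
rewrite /inside /reroute (negbTE xj); case: eqP => // ->.
move: Ji; rewrite /joins => /orP[] /eqP ->; rewrite /= ?eqxx ?(negbTE uf) /=.
  by rewrite fW => /andP[].
by rewrite fW andbT => /andP[].
Qed.

(** In the second case two edges at f lead to distinct neighbours, one of them
    in W.  Some edge at f stays in W: otherwise deleting f from W would lower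
    the cut around W by the degree of f, which [v_out] and [v_cut] limit to 1,
    and the degree of a free vertex is even. *)
Lemma free_step W F E o t rho s f : valid W F E o t rho s -> f \in F ->
  (exists2 v, (v \in W) && (v != f) & (cut E [set f] <= (mult E f v).*2)%N) \/
  (exists i j u v, [/\ v \in W, i != j, u != f, v != f & u != v]
     /\ joins E f u i /\ joins E f v j).
Proof.
move=> vI fF; have fW : f \in W := subsetP (v_free_sub vI) _ fF.
have [/exists_inP[v vW /andP[vf cv]]|/exists_inPn none] :=
   boolP [exists v in W, (v != f) && (cut E [set f] <= (mult E f v).*2)%N].
  by left; exists v; rewrite ?vW.
right; have few v : v \in W -> v != f -> ((mult E f v).*2 < cut E [set f])%N.
  by move=> /none + vf; rewrite vf /= -ltnNge.
have /set0Pn[y /setDP[yW yF]] := v_core vI.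
have yf : y != f by apply: contraNneq yF => ->.
have needW : need F rho (W :\ f) = need F rho W.
  apply: need_eq => //; apply/setP=> x; rewrite !inE.
  by case: (eqVneq x f) => [->|//]; rewrite fF.
have [j /andP[cj1 cj2]] : exists j, cross E [set f] j && cross E (W :\ f) j.
  apply/existsP; apply: contraT => /existsPn noj.
  have dis : [disjoint [set f] & W :\ f] by rewrite disjoints1 !inE eqxx.
  have := cutU E dis; rewrite setD1K // big1 => [|i _]; last by apply/eqP; rewrite eqb0.
  have pWf : W :\ f \proper W by apply: properD1.
  have := v_cut vI pWf; have := v_out vI; rewrite needW.
  have := few y yW yf; have := v_parity vI fW; rewrite (v_free vI fF).
  by lia.
have [v vf Jj] := cross1P cj1.
have vW : v \in W.
  move: cj2; rewrite /cross; move: Jj; rewrite /joins => /orP[] /eqP ->;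
  by rewrite /= !inE eqxx vf ?addbF.
have [i /andP[ci1 nJ]] : exists i, cross E [set f] i && ~~ joins E f v i.
  apply/existsP; apply: contraT => /existsPn noi.
  suff : (cut E [set f] <= mult E f v)%N by have := few v vW vf; lia.
  rewrite /mult -sum1_card /cut [leqRHS]big_mkcond /= leq_sum // => i _; rewrite inE.
  by have := noi i; case: (cross _ _ _); case: (joins _ _ _ _).
have [u uf Ji] := cross1P ci1.
exists i, j, u, v; split; last by [].
split=> //; first by apply: contraNneq nJ => ->.
by apply: contraNneq nJ => <-.
Qed.

Lemma solve1 W F E o t rho s : valid W F E o t rho s -> #|W| = 1 -> solvable W E o t.
Proof.
move=> vI /eqP/cards1P[y eW]; exists o => // v; rewrite eW inE => /eqP ->.
have := v_sum vI; rewrite eW fluxC big_set1 -rpredN.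
by rewrite opprD opprK.
Qed.

Lemma need_set1 rho y : need set0 rho [set y] = rho y.
Proof. by apply: need1; rewrite setD0. Qed.

Lemma solve2 W E o t rho s : valid W set0 E o t rho s -> #|W| = 2 -> solvable W E o t.
Proof.
move=> vI cW; have /cards2P[y [w [yw eW]]] : #|W| == 2 by rewrite cW.
have dis : [disjoint [set y] & [set w]] by rewrite disjoints1 inE.
have prop x : x \in W -> [set x] \proper W.
  by move=> xW; rewrite properEcard sub1set xW cards1 cW.
have yW : y \in W by rewrite eW !inE eqxx.
have wW : w \in W by rewrite eW !inE eqxx orbT.
have cy := v_cut vI (prop y yW); have cw := v_cut vI (prop w wW).
rewrite !need_set1 in cy cw.
have := v_out vI; rewrite need2 ?setD0 ?cW // => cWE.
have cU := cutU E dis; rewrite -eW in cU.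
have jm : (\sum_i (cross E [set y] i && cross E [set w] i) <= mult E y w)%N.
  rewrite /mult -sum1_card [leqRHS]big_mkcond /= leq_sum // => i _; rewrite inE.
  by case: andP => // -[h1 h2]; rewrite cross_joins.
apply: (base_solve vI yw eW).
have rhoP x : x \in W -> (c_special <= rho x)%N /\ (Some x != s -> (c_normal <= rho x)%N).
  move=> xW; have xC : x \in W :\: set0 by rewrite setD0.
  have [e|ne] := eqVneq (Some x) s.
    by have [h1 h2] := v_special vI xC e; split=> //; lia.
  by have [h1 h2] := v_normal vI xC ne; split=> [|_]; lia.
have [ry1 ry2] := rhoP y yW; have [rw1 rw2] := rhoP w wW.
have : Some y != s \/ Some w != s.
  by case: (eqVneq (Some y) s) => [<-|]; [right; apply: contraNneq yw => -[->] | left].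
(* Since at most one of y and w is special, the two degrees sum to at least
   c_special + c_normal, of which at most c_set + 1 edges leave W. *)
by rewrite /c_special /c_normal /c_set in cWE ry1 ry2 rw1 rw2; case=> [/ry2|/rw2]; lia.
Qed.

Lemma need_mono F F' rho B : B :\: F' \subset B :\: F ->
  (forall y, y \in B :\: F -> (rho y <= c_set)%N) -> (need F' rho B <= need F rho B)%N.
Proof.
move=> sub bd; rewrite /need; have := subset_leq_card sub.
case: ifP => h1; case: ifP => h2 // le; first by lia.
  by apply/bigmax_leqP => y /(subsetP sub); apply: bd.
by apply/bigmax_leqP => y /(subsetP sub) yB; apply: leq_bigmax_cond.
Qed.

Lemma make_free W E o t rho s y : valid W set0 E o t rho s -> (2 < #|W|)%N ->
  y \in W -> t y = 0 -> valid W [set y] E o t rho s.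
Proof.
move=> vI W3 yW ty; have toC x : x \in W :\ y -> x \in W :\: set0.
  by rewrite setD0 => /setD1P[].
have Wy : (1 < #|W :\ y|)%N by rewrite (cardsD1 y) yW in W3.
split; try by case: vI.
- by rewrite sub1set.
- by apply: contraTneq Wy => ->; rewrite cards0.
- by move=> f /set1P ->.
- by move=> x /toC; apply: (v_normal vI).
- by move=> x /toC; apply: (v_special vI).
- by move=> x /toC; apply: (v_rho vI).
- by have := v_out vI; rewrite !need2 // setD0 ltnW.
move=> B pB; apply: leq_trans (v_cut vI pB); apply: need_mono => [|x].
  by rewrite setD0 subsetDl.
by rewrite setD0 => xB; apply: (v_rho vI); rewrite setD0 (subsetP (proper_sub pB)).
Qed.

Lemma make_special W E o t rho s x (t1 := fun v => if v == x then t v - m else t v)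
    (rho1 := fun v => if v == x then absz (c_special%:Z + m - t v)%R else rho v) :
  valid W set0 E o t rho s -> (2 < #|W|)%N -> x \in W ->
  (forall y, y \in W -> Some y != s) -> valid W set0 E o t1 rho1 (Some x).
Proof.
move=> vI W3 xW ns.
have xC : x \in W :\: set0 by rewrite setD0.
have [tx0 rx] := v_normal vI xC (ns x xW); have rx2 := v_rho vI xC.
have rho1x : (rho1 x <= rho x)%N by rewrite /rho1 eqxx; move: rx; rewrite /c_normal /c_special /m; lia.
have rho1le y : (rho1 y <= rho y)%N.
  by case: (eqVneq y x) => [-> //|yx]; rewrite /rho1 (negbTE yx).
have rho1m y : y \in W :\: set0 -> (rho1 y <= c_set)%N.
  by move=> yC; apply: leq_trans (rho1le y) (v_rho vI yC).
split=> //; try by case: vI.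
- by move=> f; rewrite inE.
- move=> y yC; rewrite (inj_eq Some_inj) => yx; rewrite /t1 /rho1 (negbTE yx).
  by apply: (v_normal vI) => //; apply: ns; rewrite setD0 in yC.
- by move=> y yC [->]; rewrite /t1 /rho1 eqxx; move: rx rx2; rewrite /c_normal /c_set /m; lia.
- move=> v vW; have := v_parity vI vW; rewrite /t1; case: eqP => // _ h.
  have := rpredD h (m_dvd2 (dvdzz m)).
  by rewrite (_ : _ + m = (cut E [set v])%:Z - (t v - m)) //; ring.
- have := rpredB (v_sum vI) (dvdzz m).
  have t1x : t1 x = t x - m by rewrite /t1 eqxx.
  rewrite !(big_setD1 x xW) /= t1x.
  rewrite (eq_bigr t1) => [|v /setD1P[vx _]]; last by rewrite /t1 (negbTE vx).
  by rewrite (_ : _ - m = flux E o (~: W) + (t x - m + \sum_(i in W :\ x) t1 i)) //; ring.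
- by have := v_out vI; rewrite !need2 // setD0 ltnW.
move=> B pB; apply: leq_trans (v_cut vI pB); rewrite /need.
case: ifP => // _; apply/bigmax_leqP => y yB; apply: leq_trans (rho1le y) _.
exact: leq_bigmax_cond.
Qed.

Definition shift_edge t y x v : int :=
  if v == y then t v - 1 else if v == x then t v + 1 else t v.

(** Directing an edge from y to the special vertex x and deleting it lowers
    both degrees by 1 and brings both targets closer to 0 by 1, so y and x keep
    their slack; larger sets have slack because none of them is tight. *)
Lemma delete_valid W E o t rho x y j
    (rho1 := fun v => if (v == y) || (v == x) then (rho v).-1 else rho v) :
    valid W set0 E o t rho (Some x) -> no_tight W set0 E rho -> (2 < #|W|)%N ->
    x \in W -> y \in W -> y != x -> joins E y x j -> 0 < t y -> t x < 0 ->
  valid W set0 (drop_link E j y) o (shift_edge t y x) rho1 (Some x).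
Proof.
move=> vI nt W3 xW yW yx Jj ty tx.
have xC : x \in W :\: set0 by rewrite setD0.
have yC : y \in W :\: set0 by rewrite setD0.
have [|ty0 ry] := v_normal vI yC; first by rewrite (inj_eq Some_inj).
have [tx0 rx] := v_special vI xC (erefl _).
have ty1 : shift_edge t y x y = t y - 1 by rewrite /shift_edge eqxx.
have tx1 : shift_edge t y x x = t x + 1 by rewrite /shift_edge eq_sym (negbTE yx) eqxx.
have to1 v : v != y -> v != x -> shift_edge t y x v = t v.
  by rewrite /shift_edge => /negbTE -> /negbTE ->.
have ry1 : rho1 y = (rho y).-1 by rewrite /rho1 eqxx.
have rx1 : rho1 x = (rho x).-1 by rewrite /rho1 eqxx orbT.
have ro1 v : v != y -> v != x -> rho1 v = rho v.
  by rewrite /rho1 => /negbTE -> /negbTE ->.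
have crossE v : cross E [set v] j = (v == y) || (v == x).
  move: Jj; rewrite /joins /cross => /orP[] /eqP ->; rewrite /= !inE ![_ == v]eq_sym;
  by case: (eqVneq v y) => [->|_]; rewrite ?(negbTE yx) ?addbF.
have cutE B := drop_link_cut E j y B.
split=> //; try by case: vI.
- by move=> f; rewrite inE.
- move=> v vC; rewrite (inj_eq Some_inj) => vx.
  have [->|vy] := eqVneq v y; last first.
    by rewrite to1 ?ro1 //; apply: (v_normal vI); rewrite ?(inj_eq Some_inj).
  by rewrite ty1 ry1; move: ry; rewrite /c_normal; lia.
- by move=> v vC [->]; rewrite tx1 rx1; move: rx; rewrite /c_special; lia.
- move=> v vC; apply: leq_trans (v_rho vI vC); rewrite /rho1.
  by case: ifP => // _; apply: leq_pred.
- move=> v vW; have := v_parity vI vW; rewrite cutE crossE.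
  have [->|vy] := eqVneq v y; first by rewrite ty1 /= addn1 -natz -addn1 natrD !natz => h;
    rewrite (_ : _ - _ = Posz (cut (drop_link E j y) [set y]) + 1 - t y) //; ring.
  have [->|vx] := eqVneq v x; last by rewrite to1 //= addn0.
  rewrite tx1 /= => h; have := rpredB h (dvdzz 2); rewrite PoszD.
  by rewrite (_ : _ - _ - _ = Posz (cut (drop_link E j y) [set x]) - (t x + 1)) //; ring.
- have := v_sum vI; rewrite !(big_setD1 y yW) /= ty1.
  have xWy : x \in W :\ y by rewrite !inE eq_sym yx.
  rewrite !(big_setD1 x xWy) /= tx1.
  rewrite [\sum_(i in W :\ y :\ x) shift_edge _ _ _ _](eq_bigr t); last first.
    by move=> v; rewrite !inE => /and3P[vx vy _]; rewrite to1.
  have -> : flux (drop_link E j y) o (~: W) = flux E o (~: W).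
    apply: eq_bigr => i _; rewrite /term /drop_link; case: eqP => // ->.
    by move: Jj; rewrite /joins => /orP[] /eqP -> /=; rewrite !inE yW xW.
  by rewrite (_ : t y - 1 + _ = t y + (t x + \sum_(i in W :\ y :\ x) t i)) //; ring.
- have W2 := ltnW W3; have := v_out vI; rewrite !need2 ?setD0 //.
  by rewrite cutE; lia.
move=> B pB; have := v_cut vI pB.
have [B1|B1] := ltnP 1 #|B|.
  rewrite !need2 ?setD0 // => _; have := nt B pB B1; rewrite need2 ?setD0 // => h.
  have {h} := h (c_set_gt0); rewrite cutE; case: (cross E B j); lia.
have [->|/set0Pn[z zB]] := eqVneq B set0; first by rewrite !need0 ?sub0set.
have -> : B = [set z] by apply/eqP; rewrite eq_sym eqEcard sub1set zB cards1.
rewrite !need_set1 cutE crossE.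
have [->|zy] := eqVneq z y; first by rewrite ry1 /=; lia.
have [->|zx] := eqVneq z x; first by rewrite rx1 /=; lia.
by rewrite ro1 // addn0.
Qed.

Lemma delete_solve W E o t x y j : x \in W -> y \in W -> y != x -> joins E y x j ->
  solvable W (drop_link E j y) o (shift_edge t y x) -> solvable W E o t.
Proof.
move=> xW yW yx Jj [o1 fix1 sol1].
have [o2 fix2 flux2] := drop_link_flux E j y o1 ((E j).1 == x).
exists o2 => [i ni|v vW].
  have ij : i != j.
    apply: contraNneq ni => ->; move: Jj; rewrite /joins /inside => /orP[] /eqP -> /=;
    by rewrite xW yW.
  by rewrite fix2 // fix1 // /inside /drop_link (negbTE ij).
have := sol1 v vW; rewrite flux2.
congr (_ %| _)%Z; move: Jj; rewrite /joins /shift_edge => /orP[] /eqP -> /=; rewrite ?eqxx !inE.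
  rewrite (negbTE yx) ![_ == v]eq_sym; have [->|vy] := eqVneq v y.
    by rewrite (negbTE yx) /=; ring.
  by have [->|vx] := eqVneq v x; rewrite /=; ring.
rewrite ![_ == v]eq_sym; have [->|vy] := eqVneq v y.
  by rewrite (negbTE yx) /=; ring.
by have [->|vx] := eqVneq v x; rewrite /=; ring.
Qed.

(** A normal vertex may first become special and then free, whence the
    weights. *)
Definition weight W F E s : nat :=
  (links E + \sum_(y in W :\: F) (if Some y == s then 1 else 2))%N.

Lemma tight_or_not W F E rho : no_tight W F E rho \/
  exists B, [/\ B \proper W, (1 < #|B|)%N, (0 < need F rho B)%N
              & (cut E B <= (need F rho B).+1)%N].
Proof.
have [/existsP[B /and4P[p1 p2 p3 p4]]|/existsPn no] := boolP [exists B : {set V},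
    [&& B \proper W, 1 < #|B|, 0 < need F rho B & cut E B <= (need F rho B).+1]%N].
  by right; exists B.
left=> B p1 p2 p3; have := no B; rewrite p1 p2 p3 /= -ltnNge; lia.
Qed.

Lemma solvable_shift W E o t t' : (forall v, (m %| t' v - t v)%Z) ->
  solvable W E o t' -> solvable W E o t.
Proof.
move=> tt [o1 fix1 sol1]; exists o1 => // v vW.
have := rpredD (sol1 v vW) (tt v).
by rewrite (_ : _ - _ + _ = flux E o1 [set v] - t v) //; ring.
Qed.

(** Otherwise the cut around W would be the sum of those around x and around
    the rest, which exceeds c_set + 1. *)
Lemma neighbour W E o t rho x : valid W set0 E o t rho (Some x) -> (2 < #|W|)%N ->
  x \in W -> exists j y, [/\ y \in W, y != x & joins E y x j].
Proof.
move=> vI W3 xW; have xC : x \in W :\: set0 by rewrite setD0.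
have [j /andP[cj1 cj2]] : exists j, cross E [set x] j && cross E (W :\ x) j.
  apply/existsP; apply: contraT => /existsPn noj.
  have dis : [disjoint [set x] & W :\ x] by rewrite disjoints1 !inE eqxx.
  have := cutU E dis; rewrite setD1K // big1 => [|i _]; last by apply/eqP; rewrite eqb0.
  have px : [set x] \proper W by rewrite properEcard sub1set xW cards1 ltnW.
  have Wx : (1 < #|W :\ x|)%N by rewrite (cardsD1 x) xW in W3.
  have := v_cut vI px; have := v_cut vI (properD1 xW); have := v_out vI.
  rewrite need_set1 !need2 ?setD0 //; last by rewrite ltnW.
  by have [tx rx] := v_special vI xC (erefl _); move: rx; rewrite /c_special; lia.
have [y yx Jj] := cross1P cj1; exists j, y; split=> //; last by rewrite /joins orbC.
move: cj2; rewrite /cross; move: Jj; rewrite /joins => /orP[] /eqP ->;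
by rewrite /= !inE eqxx yx ?addbF.
Qed.

(** Tight sets are contracted first, then free vertices are split off, so that
    in the remaining steps every set of several vertices has slack 2 and all
    vertices are normal but at most one.  With three vertices or more, making
    one of them free still leaves two nonfree ones, so [need] does not change
    on W and [v_out] survives. *)
Lemma valid_solvable W F E o t rho s : valid W F E o t rho s -> solvable W E o t.
Proof.
suff H n : solves_smaller n by apply: H (ltnSn _).
elim: n => // n IHn {W F E o t rho s}.
suff H p W F E o t rho s : #|W| = n -> (weight W F E s < p)%N ->
    valid W F E o t rho s -> solvable W E o t.
  move=> W F E o t rho s; rewrite ltnS leq_eqVlt => /orP[/eqP cW|cW]; last exact: IHn.
  exact: H cW (ltnSn _).
elim: p W F E o t rho s => // p IHp W F E o t rho s cW; rewrite ltnS => wp vI.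
have IHW : solves_smaller #|W| by rewrite cW.
have [nt|[B [p1 p2 p3 p4]]] := tight_or_not W F E rho; last exact: tight_reduce IHW vI p1 p2 p3 p4.
have [F0|/set0Pn[f fF]] := eqVneq F set0; last first.
  have fW : f \in W := subsetP (v_free_sub vI) _ fF.
  have [[v /andP[vW vf] cv]|[i [j [u [v [[vW ij uf vf uv] [Ji Jj]]]]]]] := free_step vI fF.
    exact: merge_free IHW vI fF vW vf cv.
  apply: (lift_solve fW vW ij uf vf Ji Jj).
  apply: (IHp _ F _ _ _ rho s cW); last exact: lift_valid vI nt fF vW ij uf vf uv Ji Jj.
  apply: leq_trans wp; rewrite /weight ltn_add2r; exact: reroute_links Ji Jj.
subst F.
case: (ltngtP #|W| 2) => [cW2|W3|cW2]; last exact: solve2 vI cW2.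
  apply: (solve1 vI); apply/eqP; rewrite eqn_leq -ltnS cW2 card_gt0.
  by have := v_core vI; rewrite setD0.
have freeing y : y \in W -> t y = 0 -> solvable W E o t.
  move=> yW ty; apply: (IHp _ [set y] _ _ _ rho s cW); last exact: make_free vI W3 yW ty.
  apply: leq_trans wp; rewrite /weight ltn_add2l setD0 [in ltnRHS](big_setD1 y yW) /=.
  by case: ifP; lia.
case es: s vI => [x|] vI; last first.
  have [x xW] : exists x, x \in W by apply/card_gt0P; lia.
  have vI' := make_special vI W3 xW (fun _ _ => isT).
  apply: (solvable_shift _ (IHp _ _ _ _ _ _ _ cW _ vI')) => [v|].
    by case: eqP => _; rewrite ?subrr ?dvdz0 // addrAC subrr add0r rpredN dvdzz.
  apply: leq_trans wp; rewrite /weight ltn_add2l setD0 es.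
  rewrite (big_setD1 x xW) [in ltnRHS](big_setD1 x xW) /= eqxx.
  rewrite (eq_bigr (fun=> 2)) // => y /setD1P[yx _].
  by rewrite (inj_eq Some_inj) (negbTE yx).
have [xW|xW] := boolP (x \in W); last first.
  have [y yW] : exists y, y \in W by apply/card_gt0P; lia.
  have ns z : z \in W -> Some z != Some x.
    by move=> zW; apply: contraNneq xW => -[<-].
  have vI' := make_special vI W3 yW ns.
  apply: (solvable_shift _ (IHp _ _ _ _ _ _ _ cW _ vI')) => [v|].
    by case: eqP => _; rewrite ?subrr ?dvdz0 // addrAC subrr add0r rpredN dvdzz.
  apply: leq_trans wp; rewrite /weight ltn_add2l setD0 es.
  rewrite (big_setD1 y yW) [in ltnRHS](big_setD1 y yW) /= eqxx (negbTE (ns y yW)).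
  rewrite (eq_bigr (fun=> 2)) => [|z /setD1P[zy _]]; last first.
    by rewrite (inj_eq Some_inj) (negbTE zy).
  rewrite [in ltnRHS](eq_bigr (fun=> 2)) // => z /setD1P[_ zW].
  by rewrite (negbTE (ns z zW)).
have xC : x \in W :\: set0 by rewrite setD0.
have [tx0|tx0] := eqVneq (t x) 0; first exact: freeing xW tx0.
have [j [y [yW yx Jj]]] := neighbour vI W3 xW.
have yC : y \in W :\: set0 by rewrite setD0.
have [ty0|ty0] := eqVneq (t y) 0; first exact: freeing yW ty0.
have [|ty _] := v_normal vI yC; first by rewrite (inj_eq Some_inj).
have [tx _] := v_special vI xC (erefl _).
apply: (delete_solve xW yW yx Jj).
apply: (IHp _ set0 _ _ _ _ (Some x) cW _ (delete_valid vI nt W3 xW yW yx Jj _ _)); try lia.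
apply: leq_trans wp; rewrite /weight es ltn_add2r drop_link_links //.
by move: Jj; rewrite /joins => /orP[] /eqP -> //=; rewrite eq_sym.
Qed.

(** All vertices start as normal ones, with targets reduced to [0, 2k) and with
    c_set as the bound on their degrees. *)
Theorem modular_orientation E (X : {set V}) t :
    (forall i, ((E i).1 \in X) && ((E i).2 \in X)) -> X != set0 ->
    (forall B, B != set0 -> B \proper X -> (8 * k - 4 <= cut E B)%N) ->
    (forall v, v \in X -> (2 %| (cut E [set v])%:Z - t v)%Z) ->
    (m %| \sum_(v in X) t v)%Z ->
  exists o, forall v, v \in X -> (m %| flux E o [set v] - t v)%Z.
Proof.
move=> EX X0 cutX parX sumX.
have m_gt0 : 0 < m by rewrite /m; lia.
pose t1 v := (t v %% m)%Z.
have tt v : (m %| t1 v - t v)%Z by rewrite /t1 -eqz_mod_dvd modz_mod.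
pose o : I -> bool := fun=> false.
have needle B : (need set0 (fun=> c_set) B <= c_set)%N.
  by rewrite /need; case: ifP => // _; apply/bigmax_leqP.
suff vI : valid X set0 E o t1 (fun=> c_set) None.
  by have [o1 _ sol] := solvable_shift tt (valid_solvable vI); exists o1.
split=> //.
- exact: sub0set.
- by rewrite setD0.
- by move=> f; rewrite inE.
- move=> y _ _; rewrite /t1 modz_ge0 ?lt0r_neq0 //; split=> //.
  by have := ltz_pmod (t y) m_gt0; rewrite {2}/m /c_normal /c_set; lia.
- move=> v vX; have := rpredB (parX v vX) (m_dvd2 (tt v)).
  by rewrite (_ : _ - _ - _ = (cut E [set v])%:Z - t1 v) //; ring.
- rewrite {1}/flux big1 ?add0r => [|i _]; last first.
    by case/andP: (EX i) => p q; rewrite /term !inE p q subrr mulr0.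
  have : (m %| \sum_(v in X) (t1 v - t v))%Z by apply: rpred_sum.
  by rewrite sumrB => h; have := rpredD h sumX; rewrite subrK.
- rewrite /cut big1 // => i _.
  by case/andP: (EX i) => p q; rewrite /cross p q.
move=> B pB; have [->|B0] := eqVneq B set0; first by rewrite need0 ?sub0set.
exact: leq_trans (needle B) (cutX B B0 pB).
Qed.

End Orient.

(** * Dense graphs contain subgraphs with degrees divisible by k *)

Section Divisible.
Variable G : sgraph.
Implicit Types (e : edge G) (R S : {set edge G}) (A D X Z : {set G}) (v : G).

Lemma edge_pair e : exists p : G * G, adj p.1 p.2 && (val e == [set p.1; p.2]).
Proof.
case: e => e /= /imsetP[p]; rewrite inE => ap ->; exists p.
by rewrite ap eqxx.
Qed.

(** An edge is an unordered pair; this fixes an arbitrary order of its ends, so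
    that the notions for oriented multigraphs apply to graphs. *)
Definition epair e : G * G := xchoose (edge_pair e).

Lemma epair_neq e : (epair e).1 != (epair e).2.
Proof.
have /andP[+ _] := xchooseP (edge_pair e).
by apply: contraTneq => ->; rewrite adj_irrefl.
Qed.

Lemma val_epair e : val e = [set (epair e).1; (epair e).2].
Proof. by have /andP[_ /eqP] := xchooseP (edge_pair e). Qed.

Lemma in_edge e v : (v \in val e) = (v == (epair e).1) || (v == (epair e).2).
Proof. by rewrite val_epair !inE. Qed.

Lemma edge_sub e X : (val e \subset X) = ((epair e).1 \in X) && ((epair e).2 \in X).
Proof. by rewrite val_epair subUset !sub1set. Qed.

Lemma edge_degreeE S v : edge_degree S v = \sum_(e in S) (v \in val e).
Proof.
rewrite /edge_degree -sum1_card big_mkcond [RHS]big_mkcond /=.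
by apply: eq_bigr => e _; rewrite inE; case: (e \in S).
Qed.

Definition within R Z : {set edge G} := [set e in R | val e \subset Z].

Definition splits D e : bool := cross epair D e.

(** Each edge is split by half of all the vertex sets, so some vertex set splits
    at least half of the edges of R. *)
Lemma half_cut R : exists D, #|R| <= (#|[set e in R | splits D e]|).*2.
Proof.
apply/existsP; apply: contraT => /existsPn small.
have half e : (\sum_D splits D e).*2 = #|{set G}|.
  (* Toggling one end of e exchanges the sets that split e with those that do
     not. *)
  set a := (epair e).1; pose tog D := if a \in D then D :\ a else a |: D.
  have togK : involutive tog.
    move=> D; rewrite {2}/tog; case: ifP => aD; rewrite /tog !inE eqxx /=.
      by rewrite setD1K.
    by rewrite setU1K ?aD.
  have togs D : splits (tog D) e = ~~ splits D e.
    rewrite /splits /cross /tog -/a; case: ifP => aD; rewrite !inE eqxx /= ?aD;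
    by rewrite eq_sym (negbTE (epair_neq e)) //= ; case: (_ \in D).
  rewrite -addnn {2}(reindex_inj (inv_inj togK)) -big_split -sum1_card.
  by apply: eq_big => // D _; rewrite togs; case: (splits D e).
have : \sum_D (#|[set e in R | splits D e]|).*2 < \sum_(D : {set G}) #|R|.
  rewrite (bigD1 set0) //= [ltnRHS](bigD1 set0) //= -addSn leq_add //.
    by rewrite ltnNge small.
  by apply: leq_sum => D _; rewrite ltnW // ltnNge small.
rewrite sum_nat_const (eq_bigr _ (fun D _ => esym (muln2 _))) -big_distrl /=.
have -> : \sum_D #|[set e in R | splits D e]| = \sum_(e in R) \sum_D splits D e.
  rewrite exchange_big; apply: eq_bigr => D _.
  rewrite -sum1_card big_mkcond [RHS]big_mkcond /=.
  by apply: eq_bigr => e _; rewrite inE; case: (e \in R).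
rewrite big_distrl /= (eq_bigr (fun=> #|{set G}|)) => [|e _].
  by rewrite sum_nat_const mulnC ltnn.
by rewrite muln2 half.
Qed.

(** Take X of least size with more than c (|X| - 1) edges.  If A splits X, both
    parts violate this density bound, and the difference has to be made up by
    more than c edges between them. *)
Lemma dense_core R c Z : c * #|Z| < #|within R Z| ->
  exists X, [/\ X != set0, c * #|X| < #|within R X| + c
    & forall A, A != set0 -> A \proper X ->
        c < #|[set e in within R X | cross epair A e]|].
Proof.
move=> dZ; pose P X := (X != set0) && (c * #|X| < #|within R X| + c).
have PZ : P Z.
  rewrite /P ltn_addr // andbT; apply: contraTneq dZ => ->.
  rewrite cards0 muln0 -leqNgt leqn0 cards_eq0 -subset0.
  apply/subsetP=> e; rewrite inE val_epair subset0 => /andP[_ /eqP/setP/(_ (epair e).1)].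
  by rewrite !inE eqxx.
case: (arg_minnP (fun X => #|X|) PZ) => X /andP[X0 dX] minX; exists X; split=> // A A0 pA.
have AX := proper_sub pA.
have few C : C != set0 -> #|C| < #|X| -> #|within R C| + c <= c * #|C|.
  move=> C0 CX; rewrite leqNgt; apply/negP => dC.
  by have := minX C; rewrite /P C0 dC => /(_ isT); rewrite leqNgt CX.
have cX : #|X| = #|A| + #|X :\: A| by rewrite -(cardsID A X) (setIidPr AX).
have A1 : 0 < #|A| by rewrite card_gt0.
have XA0 : X :\: A != set0 by rewrite setD_eq0; case/andP: pA.
have XA1 : 0 < #|X :\: A| by rewrite card_gt0.
have fA := few A A0 (proper_card pA).
have XAX : #|X :\: A| < #|X| by lia.
have fX := few (X :\: A) XA0 XAX.
set K := [set e in _ | _].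
have : within R X \subset within R A :|: within R (X :\: A) :|: K.
  apply/subsetP=> e; rewrite !inE !edge_sub /cross !inE => /and3P[-> -> ->] /=.
  by case: (_ \in A); case: (_ \in A).
move/subset_leq_card; rewrite !cardsU.
by move: dX fA fX; rewrite cX !mulnDr; lia.
Qed.

Section Bipartite.
Variables (k : nat) (D X : {set G}) (Q : {set edge G}) (e0 : edge G) (x : G).
Hypothesis k_gt1 : 1 < k.
Hypothesis QD : forall e, e \in Q -> splits D e.
Hypothesis QX : forall e, e \in Q -> val e \subset X.
Hypothesis e0Q : e0 \in Q.
Hypothesis xX : x \in X.
Hypothesis cutQ : forall A, A != set0 -> A \proper X ->
  8 * k - 4 < #|[set e in Q | cross epair A e]|.

(** The edges of Q other than e0, directed from D to its complement; the other
    edges are loops at x. *)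
Let E e : G * G := if e \in Q :\ e0 then
  (if (epair e).1 \in D then epair e else ((epair e).2, (epair e).1)) else (x, x).

Let EQ A e : e \in Q :\ e0 -> cross E A e = cross epair A e.
Proof. by rewrite /cross /E => ->; case: ifP => _ //; rewrite addbC. Qed.

Let EQn A e : e \notin Q :\ e0 -> cross E A e = false.
Proof. by rewrite /cross /E => /negbTE ->; rewrite addbb. Qed.

Let cut_bound A : A != set0 -> A \proper X -> 8 * k - 4 <= cut E A.
Proof.
move=> A0 pA; rewrite -ltnS; apply: leq_trans (cutQ A0 pA) _.
set K := [set e in Q | _]; rewrite (cardsD1 e0 K) -addn1 addnC leq_add ?leq_b1 //.
rewrite -sum1_card big_mkcond /cut leq_sum //= => e _.
rewrite !inE; case: ifP => // /and3P[ee0 eQ ce].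
by rewrite EQ ?ce // !inE ee0.
Qed.

Local Open Scope ring_scope.

Let sg v : int := if v \in D then -1 else 1.

(** Let the edges chosen by an orientation be those going from D to the
    complement.  At a vertex v outside D the net flow is the degree of v minus
    twice its number of chosen edges, so this target says that this number,
    plus 1 at the ends of e0, is divisible by k; inside D signs are reversed.
    The edge e0 is counted in both summands since it is in Q. *)
Let t v : int := sg v * \sum_(e in Q) (v \in val e)%:R + sg v * (v \in val e0)%:R.

Let cut1 v : cut E [set v] = (\sum_(e in Q :\ e0) (v \in val e))%N.
Proof.
rewrite /cut [RHS]big_mkcond; apply: eq_bigr => e _ /=.
case: ifP => eQ; last by rewrite EQn ?eQ.
rewrite EQ // /cross !inE in_edge ![_ == v]eq_sym.
by case: eqVneq => [->|] //=; rewrite (negbTE (epair_neq e)).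
Qed.

Let flux1 o v : flux E o [set v] =
  - sg v * \sum_(e in Q :\ e0) (-1) ^+ o e * (v \in val e)%:R.
Proof.
rewrite /flux mulr_sumr [RHS]big_mkcond; apply: eq_bigr => e _ /=.
rewrite /term /E; case: ifP => eQ /=; last by rewrite subrr mulr0.
have := QD (setD1P eQ).2; rewrite /splits /cross in_edge !inE.
have := epair_neq e; case: (epair e) => p q /= pq; rewrite /sg ![_ == v]eq_sym.
case: (boolP (p \in D)) => pD /=; case: (boolP (q \in D)) => qD //= _.
  have [->|vp] := eqVneq v p; first by rewrite pD (negbTE pq) /=; ring.
  by have [->|vq] := eqVneq v q; rewrite ?(negbTE qD) /=; ring.
have [->|vp] := eqVneq v p; first by rewrite (negbTE pD) (negbTE pq) /=; ring.
by have [->|vq] := eqVneq v q; rewrite ?qD /=; ring.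
Qed.

Let sum_sg e : e \in Q -> \sum_(v in X) sg v * (v \in val e)%:R = 0.
Proof.
move=> eQ; have := QX eQ; have := QD eQ; rewrite edge_sub /splits /cross.
have ne := epair_neq e => sp /andP[pX qX].
rewrite (big_setD1 (epair e).1 pX) /= (big_setD1 (epair e).2) ?inE 1?eq_sym ?ne //=.
rewrite big1 ?addr0 => [|v]; last first.
  by rewrite !inE in_edge => /and3P[/negbTE -> /negbTE -> _]; rewrite mulr0.
rewrite !in_edge !eqxx orbT /sg.
by move: sp; case: (_ \in D); case: (_ \in D).
Qed.

Lemma bipartite_divisible : exists S : {set edge G},
  [/\ S != set0, S \subset Q & forall v, (k %| edge_degree S v)%N].
Proof.
have EX e : ((E e).1 \in X) && ((E e).2 \in X).
  rewrite /E; case: ifP => eQ; last by rewrite xX.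
  have := QX (setD1P eQ).2; rewrite edge_sub => /andP[pX qX].
  by case: ifP; rewrite /= pX qX.
have [|||o sol] := modular_orientation k_gt1 EX (t := t) _ cut_bound.
- by apply/set0Pn; exists x.
- move=> v vX; rewrite cut1 /t (big_setD1 e0 e0Q) /= Posz_sum.
  set s := \sum_(e in _) _; rewrite /sg.
  case: ifP => _.
    by rewrite (_ : _ - _ = 2 * ((v \in val e0)%:R + s)) ?dvdz_mulr //; ring.
  by rewrite (_ : _ - _ = 2 * - (v \in val e0)%:R) ?dvdz_mulr //; ring.
- rewrite big_split /= (sum_sg e0Q) addr0.
  under eq_bigr do rewrite mulr_sumr.
  by rewrite exchange_big big1 //= => e; apply: sum_sg.
pose S := e0 |: [set e in Q :\ e0 | ~~ o e].
have SQ : S \subset Q.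
  by apply/subsetP=> e; rewrite !inE => /orP[/eqP -> //|/andP[/andP[]]].
exists S; split=> // [|v]; first by apply/set0Pn; exists e0; rewrite setU11.
have [vX|vX] := boolP (v \in X); last first.
  rewrite edge_degreeE big1 // => e /(subsetP SQ)/QX/subsetP/(_ v) h.
  by apply/eqP; rewrite eqb0; apply: contra vX.
have := sol v vX; rewrite flux1 /t.
have degS : (edge_degree S v)%:Z * 2 = (v \in val e0)%:R * 2
   + \sum_(e in Q :\ e0) ((-1) ^+ o e + 1) * (v \in val e)%:R.
  rewrite edge_degreeE big_setU1 ?inE ?eqxx //= PoszD mulrDl; congr (_ + _); first by case: (v \in _).
  rewrite Posz_sum mulr_suml big_mkcond [RHS]big_mkcond; apply: eq_bigr => e _ /=.
  rewrite inE; case: (e \in Q :\ e0) => //=.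
  by case: (o e) => /=; ring.
rewrite (big_setD1 e0 e0Q) /=.
have -> : - sg v * (\sum_(e in Q :\ e0) (-1) ^+ o e * (v \in val e)%:R)
   - (sg v * ((v \in val e0)%:R + \sum_(e in Q :\ e0) (v \in val e)%:R)
       + sg v * (v \in val e0)%:R) = - sg v * ((edge_degree S v)%:Z * 2).
  rewrite degS; under [in RHS]eq_bigr do rewrite mulrDl mul1r.
  by rewrite big_split /=; ring.
have sgu x0 : (((2 * k)%N%:Z %| - sg v * x0) = ((2 * k)%N%:Z %| x0))%Z.
  by rewrite /sg; case: ifP; rewrite ?opprK ?mul1r // mulN1r rpredN.
rewrite sgu mulrC -[2]/(Posz 2) -PoszM dvdzE.
by rewrite /absz dvdn_pmul2l.
Qed.

End Bipartite.

Lemma divisible_subgraph k R Z : 1 < k ->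
    2 * (8 * k - 4) * #|Z| < #|within R Z| ->
  exists S, [/\ S != set0, S \subset within R Z
    & forall v, k %| edge_degree S v].
Proof.
move=> k1 dR; have [D hD] := half_cut (within R Z).
set Q0 := [set e in _ | _] in hD.
have wQ0 : within Q0 Z = Q0.
  apply/setP=> e; rewrite !inE; case: (_ \subset _); by rewrite ?andbT ?andbF.
have dQ0 : (8 * k - 4) * #|Z| < #|within Q0 Z| by rewrite wQ0; lia.
have [X [X0 dX cX]] := dense_core dQ0.
have X1 : 0 < #|X| by rewrite card_gt0.
have /card_gt0P[e0 e0Q] : 0 < #|within Q0 X| by nia.
have /set0Pn[x xX] := X0.
have [||S [S0 SQ dS]] := bipartite_divisible (D := D) k1 _ _ e0Q xX cX.
- by move=> e; rewrite !inE => /andP[/andP[]].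
- by move=> e; rewrite inE => /andP[].
exists S; split=> //; apply: subset_trans SQ _.
by apply/subsetP=> e; rewrite inE => /andP[]; rewrite inE => /andP[].
Qed.

End Divisible.

(** * List colouring the edges at one vertex *)

Definition class_size_ok k n : bool := (n == 0) || (n == 1 %[mod k]).

Section ListColour.
Variables (T C : finType) (k h : nat) (forb : T -> {set C}).
Hypothesis k_gt0 : 0 < k.
Implicit Types (U L B : {set T}) (P : {set C}) (g : T -> C).

(** The largest size congruent to 1 modulo k is used. *)
Lemma large_class U : exists2 B : {set T}, B \subset U &
  class_size_ok k #|B| /\ #|U :\: B| <= k - 1.
Proof.
have [U0|U0] := posnP #|U|.
  exists U => //; rewrite /class_size_ok U0; split=> //.
  by rewrite setDv cards0.
have [|B BU cB] := @subset_of_card T U (#|U| - (#|U| - 1) %% k).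
  exact: leq_subr.
exists B => //; have := ltn_pmod (#|U| - 1) k_gt0.
have := leq_mod (#|U| - 1) k; rewrite /class_size_ok cardsD (setIidPr BU) => h1 h2.
split; last by lia.
have -> : #|B| = (#|U| - 1) %/ k * k + 1.
  by rewrite cB; have := divn_eq (#|U| - 1) k; set q := _ * k; lia.
by rewrite modnMDl eqxx orbT.
Qed.

(** The colours of cs are treated in turn, each taking as many of the remaining
    items that allow it as a size 1 modulo k permits.  What is left over allows
    each colour of cs fewer than k times. *)
Lemma big_classes U (cs : seq C) (c0 : C) : uniq cs ->
  exists g L, [/\ L \subset U,
    forall e, e \in U :\: L -> (g e \in cs) && (g e \notin forb e),
    forall c, class_size_ok k #|[set e in U :\: L | g e == c]|
    & forall c, c \in cs -> #|[set e in L | c \notin forb e]| <= k - 1].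
Proof.
elim: cs U => [|c cs IH] U /=.
  move=> _; exists (fun=> c0), U; split=> // [e|c]; first by rewrite setDv inE.
  by rewrite (_ : [set e in _ | _] = set0) ?cards0 //; apply/setP=> e; rewrite setDv !inE.
case/andP=> ccs /IH{}IH.
have [B BA [okB cB]] := large_class [set e in U | c \notin forb e].
have [g [L [LU gL okL cL]]] := IH (U :\: B).
have BU : B \subset U by apply: subset_trans BA _; apply/subsetP=> e; rewrite inE => /andP[].
have LB e : e \in L -> e \notin B by move/(subsetP LU)/setDP => [].
exists (fun e => if e \in B then c else g e), L; split.
- by apply: subset_trans LU (subsetDl _ _).
- move=> e /setDP[eU eL]; case: ifP => eB.
    by have := subsetP BA e eB; rewrite !inE eqxx => /andP[_ ->].
  by have := gL e; rewrite !inE eL eB eU => /(_ isT)/andP[-> ->]; rewrite orbT.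
- move=> c'; have [->|cc'] := eqVneq c' c.
    rewrite (_ : [set e in _ | _] = B) //; apply/setP=> e; rewrite !inE.
    have [eB|eB] := boolP (e \in B); first by rewrite eqxx (subsetP BU) // (contraL (@LB e)).
    apply/negbTE; apply: contra ccs => /andP[/andP[eL eU] /eqP <-].
    by have := gL e; rewrite !inE eL eB eU => /(_ isT)/andP[].
  rewrite (_ : [set e in _ | _] = [set e in U :\: B :\: L | g e == c']) //.
  apply/setP=> e; rewrite !inE; have [eB|eB] := boolP (e \in B); last by [].
  by rewrite eq_sym (negbTE cc') !andbF.
move=> c'; rewrite inE => /orP[/eqP ->|/cL //].
apply: leq_trans cB; apply: subset_leq_card; apply/subsetP=> e; rewrite !inE.
by move=> /andP[eL ->]; rewrite LB //; have := subsetP LU e eL; rewrite !inE => /andP[_ ->].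
Qed.

Lemma rainbow L P (c0 : C) : (forall e, e \in L -> #|forb e| <= h) -> h + #|L| <= #|P| ->
  exists g, {in L &, injective g} /\ forall e, e \in L -> g e \in P :\: forb e.
Proof.
have [n cL] : exists n, #|L| = n by exists #|L|.
elim: n L cL => [|n IH] L cL fL hL.
  by exists (fun=> c0); split=> [e e'|e]; rewrite (cards0_eq cL) inE.
have [e eL] : exists e, e \in L by apply/card_gt0P; rewrite cL.
have cLe : #|L :\ e| = n by move: cL; rewrite (cardsD1 e) eL => -[].
have [||g [ginj gP]] := IH _ cLe.
- by move=> e' /setD1P[_]; apply: fL.
- by rewrite cLe; lia.
have [c] : exists c, c \in P :\: forb e :\: g @: (L :\ e).
  apply/card_gt0P; have := fL e eL; have := leq_imset_card g (L :\ e).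
  rewrite cLe => h1 h2; rewrite !cardsD.
  have := subset_leq_card (subsetIr (P :\: forb e) (g @: (L :\ e))).
  by have := subset_leq_card (subsetIr P (forb e)); lia.
rewrite !inE => /and3P[cg cf cP].
have other e' : e' \in L -> e' != e -> e' \in L :\ e by move=> eL' ee'; rewrite !inE ee'.
have fresh e' : e' \in L -> e' != e -> g e' != c.
  by move=> eL' ee'; apply: contraNneq cg => <-; apply: imset_f; apply: other.
exists (fun e' => if e' == e then c else g e'); split.
  move=> e1 e2 e1L e2L; case: (eqVneq e1 e) => [->|n1]; case: (eqVneq e2 e) => [->|n2] //.
  - by move=> /esym/eqP; rewrite (negbTE (fresh e2 _ _)).
  - by move=> /eqP; rewrite (negbTE (fresh e1 _ _)).
  by apply: ginj; apply: other.
move=> e' eL'; case: eqP => [->|/eqP ne]; first by rewrite !inE cf cP.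
by apply: gP; apply: other.
Qed.

(** After 2h + 1 colours have been used greedily, each leftover item still
    allows at least h + 1 of them, while each of them is allowed by at most
    k - 1 leftover items.  Double counting leaves at most 2 (k - 1) items, which
    receive distinct colours not used before. *)
Lemma list_colour U P : (forall e, e \in U -> #|forb e| <= h) ->
    3 * h + 1 + 2 * (k - 1) <= #|P| ->
  exists g, (forall e, e \in U -> g e \in P :\: forb e)
    /\ forall c, class_size_ok k #|[set e in U | g e == c]|.
Proof.
move=> fU hP; have [c0 c0P] : exists c, c \in P by apply/card_gt0P; lia.
have [|Q QP cQ] := @subset_of_card C P (2 * h + 1); first by lia.
have [g1 [L [LU gL okL cL]]] := big_classes U c0 (enum_uniq Q).
have Lsmall : #|L| * (h + 1) <= (2 * h + 1) * (k - 1).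
  rewrite -cQ -[leqRHS]sum_nat_const.
  apply: (@leq_trans (\sum_(c in Q) #|[set e in L | c \notin forb e]|)); last first.
    by apply: leq_sum => c cQ'; apply: cL; rewrite mem_enum.
  rewrite -sum_nat_const.
  rewrite (eq_bigr (fun c => \sum_(e in L) (c \notin forb e))) => [|c _]; last first.
    rewrite -sum1_card big_mkcond [RHS]big_mkcond /=; apply: eq_bigr => e _.
    by rewrite inE; case: (e \in L).
  rewrite exchange_big leq_sum //= => e eL.
  rewrite (_ : \sum_(c in Q) _ = #|Q :\: forb e|).
    rewrite cardsD cQ; have := subset_leq_card (subsetIr Q (forb e)).
    by have := fU e (subsetP LU e eL); lia.
  rewrite -sum1_card big_mkcond [RHS]big_mkcond /=; apply: eq_bigr => c _.
  by rewrite inE; case: (c \in Q); rewrite ?andbF ?andbT.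
have Lk : #|L| <= 2 * (k - 1) by nia.
have [||g2 [g2inj g2P]] := @rainbow L (P :\: Q) c0.
- by move=> e /(subsetP LU); apply: fU.
- by rewrite cardsD (setIidPr QP) cQ; lia.
exists (fun e => if e \in L then g2 e else g1 e); split=> [e eU|c].
  case: ifP => eL; first by have := g2P e eL; rewrite !inE => /and3P[-> _ ->].
  have := gL e; rewrite !inE eL eU mem_enum => /(_ isT)/andP[g1Q ->].
  by rewrite (subsetP QP).
have [cQ'|cQ'] := boolP (c \in Q).
  rewrite (_ : [set e in _ | _] = [set e in U :\: L | g1 e == c]) //.
  apply/setP=> e; rewrite !inE; case: ifP => eL //=; rewrite andbC.
  case: eqP => //= ec; have := g2P e eL.
  by rewrite ec !inE cQ' andbF.
have : #|[set e in U | (if e \in L then g2 e else g1 e) == c]| <= 1.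
  apply/card_le1_eqP => e1 e2; rewrite !inE.
  have inL e : e \in U -> (if e \in L then g2 e else g1 e) == c -> (e \in L) && (g2 e == c).
    move=> eU; case: ifP => //= eL /eqP ec; have := gL e.
    by rewrite !inE eL eU mem_enum ec (negbTE cQ') => /(_ isT).
  move=> /andP[u1 /(inL _ u1)/andP[l1 /eqP c1]] /andP[u2 /(inL _ u2)/andP[l2 /eqP c2]].
  by apply: g2inj => //; rewrite c1 c2.
by rewrite /class_size_ok; case: #|_| => [|[|]] //=; rewrite eqxx.
Qed.

End ListColour.

(** * Colouring degenerate graphs *)

Section Degenerate.
Variables (G : sgraph) (R : {set edge G}) (d : nat).
Implicit Types (e : edge G) (Z : {set G}) (u v w : G).
Hypothesis degR : forall Z, Z != set0 ->
  exists2 v, v \in Z & edge_degree (within R Z) v <= d.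

Lemma degenerate_order_on n Z : #|Z| = n -> exists rk : G -> nat,
  [/\ {in Z &, injective rk}, forall v, v \in Z -> rk v < n
    & forall w, w \in Z ->
      #|[set e in within R Z | (w \in val e) && [forall x in val e, rk x <= rk w]]| <= d].
Proof.
elim: n Z => [|n IH] Z cZ.
  by exists (fun=> 0); rewrite (cards0_eq cZ); split=> [v w|v|v]; rewrite inE.
have [|v vZ dv] := degR (Z := Z); first by rewrite -card_gt0 cZ.
have cZv : #|Z :\ v| = n by move: cZ; rewrite (cardsD1 v) vZ => -[].
have [rk [rinj rn rd]] := IH _ cZv.
have inZ w : w \in Z -> w != v -> w \in Z :\ v by move=> wZ wv; rewrite !inE wv.
exists (fun w => if w == v then n else rk w); split.
- move=> a b aZ bZ; case: (eqVneq a v) => [->|av]; case: (eqVneq b v) => [->|bv] // e.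
  + by have := rn b (inZ b bZ bv); rewrite -e ltnn.
  + by have := rn a (inZ a aZ av); rewrite e ltnn.
  by apply: rinj => //; apply: inZ.
- by move=> w wZ; case: eqP => // /eqP wv; rewrite ltnW // ltnS rn // inZ.
move=> w wZ; have [->|wv] := eqVneq w v.
  apply: leq_trans dv; apply: subset_leq_card; apply/subsetP=> e.
  by rewrite !inE => /andP[-> /andP[-> _]].
apply: leq_trans (rd w (inZ w wZ wv)); apply: subset_leq_card; apply/subsetP=> e.
rewrite !inE => /andP[/andP[-> eZ] /andP[-> /forall_inP le]] /=.
have nv x : x \in val e -> x != v.
  move=> xe; have := le x xe; case: eqP => // _.
  by rewrite leqNgt rn // inZ.
apply/andP; split; first by apply/subsetP=> x xe; rewrite !inE nv // (subsetP eZ).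
by apply/forall_inP=> x xe; have := le x xe; rewrite (negbTE (nv x xe)).
Qed.

Lemma degenerate_order : exists rk : G -> nat, injective rk /\
  forall w, #|[set e in R | (w \in val e) && [forall x in val e, rk x <= rk w]]| <= d.
Proof.
have [rk [rinj _ rd]] := degenerate_order_on (erefl #|[set: G]|).
exists rk; split=> [a b|w]; first by apply: rinj; rewrite inE.
apply: leq_trans (rd w (in_setT w)); apply: subset_leq_card; apply/subsetP=> e.
by rewrite !inE subsetT andbT.
Qed.

Definition other u e : G := if (epair e).1 == u then (epair e).2 else (epair e).1.

Lemma otherP u e : u \in val e -> other u e != u /\ val e = [set u; other u e].
Proof.
rewrite in_edge /other val_epair => /orP[] /eqP ->.
  by rewrite eqxx eq_sym epair_neq.
by rewrite (negbTE (epair_neq e)) epair_neq setUC.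
Qed.

(** Before step i the edges with an end of rank below i have their final
    colours: vertices of rank below i are done, and at every other vertex these
    edges have pairwise distinct colours.  They lead to vertices of smaller
    rank, so there are at most d of them, and at most d - 1 at the later end of
    an edge still to be coloured. *)
Lemma degenerate_colour (C : finType) k : 0 < k -> 0 < d ->
    4 * d + 2 * k - 4 <= #|C| ->
  exists f : edge G -> C, forall u c,
    class_size_ok k #|[set e in R | (u \in val e) && (f e == c)]|.
Proof.
move=> k0 d0 hC; have [rk [rinj back]] := degenerate_order.
have C0 : 0 < #|C| by lia.
have /card_gt0P[c0 _] := C0.
pose early i e := [exists x in val e, rk x < i].
suff H i : exists f : edge G -> C,
    (forall u c, rk u < i -> class_size_ok k #|[set e in R | (u \in val e) && (f e == c)]|)
    /\ (forall w e1 e2, i <= rk w -> e1 \in R -> e2 \in R -> w \in val e1 -> w \in val e2 ->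
          early i e1 -> early i e2 -> f e1 = f e2 -> e1 = e2).
  have [f [fok _]] := H (\max_u rk u).+1; exists f => u c; apply: fok.
  by rewrite ltnS leq_bigmax.
elim: i => [|i [f [fok finj]]].
  by exists (fun=> c0); split=> // w e1 e2 _ _ _ _ _ /exists_inP[].
have [/existsP[u /eqP ui]|/existsPn nou] := boolP [exists u, rk u == i]; last first.
  have lt_i x : (rk x < i.+1) = (rk x < i).
    by rewrite ltnS leq_eqVlt (negbTE (nou x)).
  have earlyS e : early i.+1 e = early i e.
    by apply: eq_existsb => x; rewrite lt_i.
  exists f; split=> [x c|w e1 e2 wi]; first by rewrite lt_i; apply: fok.
  by rewrite !earlyS; apply: finj; apply: ltnW.
pose U := [set e in R | (u \in val e) && ~~ early i e].
pose old w := [set e in R | (w \in val e) && early i e].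
have late e x : ~~ early i e -> x \in val e -> i <= rk x.
  by move=> /exists_inPn ne /ne; rewrite -leqNgt.
have old_back w : i <= rk w ->
    old w \subset [set e in R | (w \in val e) && [forall x in val e, rk x <= rk w]].
  move=> iw; apply/subsetP=> e; rewrite !inE => /and3P[-> we /exists_inP[y ye yi]].
  rewrite we /=; apply/forall_inP=> x; have [_ ew] := otherP we.
  have yw : y != w by apply: contraTneq yi => ->; rewrite -leqNgt.
  have oy : other w e = y by move: ye; rewrite ew !inE (negbTE yw) => /eqP.
  by rewrite ew oy !inE => /orP[] /eqP -> //; apply: ltnW (leq_trans yi iw).
have forb_small e : e \in U -> #|f @: old (other u e)| <= d - 1.
  rewrite inE => /and3P[eR ue ne]; have [nu eu] := otherP ue.
  set w := other u e in nu eu *.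
  have we : w \in val e by rewrite eu !inE eqxx orbT.
  have iw : i <= rk w := late e w ne we.
  have : e |: old w \subset [set e in R | (w \in val e) && [forall x in val e, rk x <= rk w]].
    rewrite subUset old_back // andbT sub1set inE eR we /=.
    by apply/forall_inP=> x; rewrite eu !inE => /orP[] /eqP ->; rewrite ?ui.
  move=> /subset_leq_card/leq_trans/(_ (back w)); rewrite cardsU1 inE (negbTE ne) !andbF /=.
  by move=> od; rewrite subn1 -ltnS prednK //; apply: leq_ltn_trans (leq_imset_card f _) od.
have pal : 3 * (d - 1) + 1 + 2 * (k - 1) <= #|~: (f @: old u)|.
  rewrite cardsCs setCK; have := leq_imset_card f (old u).
  have ou : #|old u| <= d.
    by apply: leq_trans (back u); apply/subset_leq_card/old_back; rewrite ui.
  by have := max_card (mem (f @: old u)); lia.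
have [g [gU gok]] := list_colour k0 forb_small pal.
exists (fun e => if e \in U then g e else f e); split=> [v c|w e1 e2 iw e1R e2R w1 w2].
  rewrite ltnS leq_eqVlt => /orP[/eqP vi|vi]; last first.
    rewrite (_ : [set e in R | _] = [set e in R | (v \in val e) && (f e == c)]) ?fok //.
    apply/setP=> e; rewrite [LHS]inE [RHS]inE; case ve: (v \in val e); rewrite ?andbF //=.
    case: ifP => // ; rewrite inE => /and3P[_ _ ne].
    by have := late e v ne ve; rewrite leqNgt vi.
  have -> : v = u by apply: rinj; rewrite ui.
  have [cQ|cQ] := boolP (c \in f @: old u).
    suff le1 : #|[set e in R | (u \in val e) && ((if e \in U then g e else f e) == c)]| <= 1.
      by move: le1; rewrite /class_size_ok; case: #|_| => [|[|]] //=; rewrite eqxx.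
    have notU e : (if e \in U then g e else f e) == c -> e \notin U /\ f e == c.
      case: ifP => // eU /eqP gc; have := gU e eU.
      by rewrite gc !inE cQ andbF.
    apply/card_le1_eqP => e1 e2; rewrite [e1 \in _]inE [e2 \in _]inE.
    move=> /and3P[r1 u1 /notU[nU1 /eqP c1]] /and3P[r2 u2 /notU[nU2 /eqP c2]].
    have ear e : e \in R -> u \in val e -> e \notin U -> early i e.
      by move=> eR ue; rewrite inE eR ue /= negbK.
    by apply: (finj u); rewrite ?ui ?c1 ?c2 //; apply: ear.
  rewrite (_ : [set e in R | _] = [set e in U | g e == c]) //.
  apply/setP=> e; rewrite [LHS]inE [RHS]inE; case: ifP => eU.
    by move: eU; rewrite inE => /and3P[-> -> _].
  apply/negbTE; apply: contra cQ => /and3P[eR ue /eqP <-]; apply: imset_f.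
  by move: eU; rewrite !inE eR ue /= => /negbFE.
have newU e : e \in R -> early i.+1 e -> ~~ early i e -> e \in U.
  move=> eR /exists_inP[x xe]; rewrite ltnS leq_eqVlt => /orP[/eqP xi|xi] ne.
    by rewrite inE eR ne andbT -(rinj x u) ?xi.
  by case/exists_inP: ne; exists x.
have wu : w != u by apply: contraTneq iw => ->; rewrite ui ltnn.
have wo e : e \in U -> w \in val e -> other u e = w.
  rewrite inE => /and3P[_ ue _]; have [_ eu] := otherP ue.
  by rewrite eu !inE (negbTE wu) => /eqP.
have clash e e' : e \in U -> e' \in R -> e' \notin U -> w \in val e -> w \in val e' ->
    early i.+1 e' -> g e <> f e'.
  move=> eU e'R e'U we we' ear gf; have := gU e eU; rewrite (wo e eU we) inE gf.
  rewrite imset_f // inE e'R we' /=; apply: contraNT e'U; exact: newU.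
move=> s1 s2; case: ifP => U1; case: ifP => U2.
- move=> _; apply: val_inj; have := wo e1 U1 w1; have := wo e2 U2 w2.
  move: U1 U2; rewrite !inE => /and3P[_ u1 _] /and3P[_ u2 _].
  by have [_ ->] := otherP u1; have [_ ->] := otherP u2; move=> -> ->.
- by move=> /(clash e1 e2 U1 e2R (negbT U2) w1 w2 s2).
- by move=> /esym /(clash e2 e1 U2 e1R (negbT U1) w2 w1 s1).
have ear e : e \in R -> early i.+1 e -> (e \in U) = false -> early i e.
  by move=> eR se; apply: contraFT => /(newU e eR se).
by apply: (finj w) => //; [apply: ltnW | apply: ear | apply: ear].
Qed.

End Degenerate.

(** * The sparse complement of a largest subgraph with degrees 1 modulo k *)

Lemma card_bigcup_leq (T J : finType) (A : {set J}) (B : J -> {set T}) :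
  #|\bigcup_(i in A) B i| <= \sum_(i in A) #|B i|.
Proof.
elim/big_rec2: _ => [|i n C _ le]; first by rewrite cards0.
by apply: leq_trans (leq_card_setU _ _) _; rewrite leq_add2l.
Qed.

Section Maximal.
Variables (G : sgraph) (k : nat).
Hypothesis k_gt1 : 1 < k.
Implicit Types (e : edge G) (R S H K : {set edge G}) (X Z : {set G}) (u v x : G).

Definition mod1_set H : bool := [forall v, class_size_ok k (edge_degree H v)].

Lemma edge_degreeU S H v : [disjoint H & S] ->
  edge_degree (H :|: S) v = edge_degree H v + edge_degree S v.
Proof.
move=> dis; rewrite !edge_degreeE -bigU //=; apply: eq_bigl => e.
by rewrite inE.
Qed.

Lemma edge_degree_eq0 S v : (forall e, e \in S -> v \notin val e) -> edge_degree S v = 0.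
Proof. by move=> no; rewrite edge_degreeE big1 // => e /no /negbTE ->. Qed.

Lemma card_edge e : #|val e| = 2.
Proof. by rewrite val_epair cards2 epair_neq. Qed.

Lemma sum_edge_degree R Z :
  \sum_(v in Z) edge_degree (within R Z) v = 2 * #|within R Z|.
Proof.
under eq_bigr do rewrite edge_degreeE.
rewrite exchange_big /= mulnC -sum_nat_const; apply: eq_bigr => e.
rewrite inE => /andP[_ eZ]; rewrite -(card_edge e) -sum1_card.
rewrite big_mkcond [RHS]big_mkcond; apply: eq_bigr => v _ /=.
by have := subsetP eZ v; case: (v \in val e) => [/(_ isT) -> //|_]; case: ifP.
Qed.

Variable H : {set edge G}.
Hypothesis H_ok : mod1_set H.
Hypothesis H_max : forall H', mod1_set H' -> #|H'| <= #|H|.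

Let R := ~: H.
Let X := [set v | 0 < edge_degree H v].

Lemma no_extension S : S != set0 -> S \subset R ->
  (forall v, class_size_ok k (edge_degree H v + edge_degree S v)) -> False.
Proof.
move=> S0 SR ok; have dis : [disjoint H & S].
  by rewrite disjoint_sym disjoints_subset.
have /H_max : mod1_set (H :|: S) by apply/forallP=> v; rewrite edge_degreeU.
rewrite cardsU (disjoint_setI0 dis) cards0 subn0 -{2}[#|H|]addn0 leq_add2l leqn0.
by rewrite cards_eq0 (negbTE S0).
Qed.

Lemma covered_degree v : v \in X -> edge_degree H v = 1 %[mod k].
Proof.
rewrite inE; have := forallP H_ok v; rewrite /class_size_ok.
by case: (edge_degree H v) => [|n] //= /eqP.
Qed.

Lemma uncovered_degree v : v \notin X -> edge_degree H v = 0.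
Proof. by rewrite inE -eqn0Ngt => /eqP. Qed.

Lemma covered_sparse Z : Z \subset X -> #|within R Z| <= 2 * (8 * k - 4) * #|Z|.
Proof.
move=> ZX; rewrite leqNgt; apply/negP=> /(divisible_subgraph k_gt1)[S [S0 SR dS]].
apply: (no_extension S0) => [|v].
  by apply: subset_trans SR _; apply/subsetP=> e; rewrite inE => /andP[].
have [vX|vX] := boolP (v \in X).
  apply/orP; right; apply/eqP; have /eqP dv := dS v.
  by rewrite -modnDmr dv addn0 covered_degree.
rewrite uncovered_degree // edge_degree_eq0 // => e /(subsetP SR).
rewrite inE => /andP[_ /subsetP eZ]; apply: contra vX => /eZ; exact: subsetP ZX v.
Qed.

Lemma uncovered_independent e u : e \in R -> u \in val e -> u \notin X ->
  other u e \in X.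
Proof.
move=> eR ue uX; apply: contraT => oX; exfalso.
have [_ eu] := otherP ue.
apply: (@no_extension [set e]) => [||v]; first by apply/set0Pn; exists e; rewrite set11.
  by rewrite sub1set.
rewrite [edge_degree [set e] v]edge_degreeE big_set1; case ve: (v \in val e); last first.
  by rewrite addn0; apply: forallP H_ok v.
have vX : v \notin X by move: ve; rewrite eu in_set2 => /orP[] /eqP ->.
by rewrite uncovered_degree // /class_size_ok /= eqxx.
Qed.

(** Adding k of these edges to H keeps the degree of x at 1 modulo k, and gives
    degree 1 to k vertices not met by H. *)
Lemma few_pendants x : x \in X ->
  #|[set e in R | (x \in val e) && (other x e \notin X)]| <= k - 1.
Proof.
move=> xX; set K := [set e in R | _]; rewrite leqNgt; apply/negP=> bigK.
have [|S SK cS] := @subset_of_card _ K k; first by lia.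
have SP e : e \in S -> [/\ e \in R, x \in val e & other x e \notin X].
  by move/(subsetP SK); rewrite inE => /and3P.
apply: (@no_extension S) => [||v].
- by rewrite -card_gt0 cS; lia.
- by apply/subsetP=> e /SP[].
have [->|vx] := eqVneq v x.
  apply/orP; right; rewrite [edge_degree S x]edge_degreeE (eq_bigr (fun=> 1)) => [|e /SP[_ -> _] //].
  by rewrite sum1_card cS modnDr covered_degree.
have vo e : e \in S -> v \in val e -> v = other x e.
  move=> /SP[_ xe _]; have [_ ->] := otherP xe.
  by rewrite !inE (negbTE vx) => /eqP.
have [vX|vX] := boolP (v \in X).
  rewrite [edge_degree S v]edge_degree_eq0 ?addn0; first exact: forallP H_ok v.
  move=> e eS; apply/negP=> ve; have [_ _] := SP e eS.
  by rewrite -(vo e eS ve) vX.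
rewrite uncovered_degree // add0n.
suff : edge_degree S v <= 1.
  by rewrite /class_size_ok; case: (edge_degree S v) => [|[|]] //=; rewrite eqxx.
apply/card_le1_eqP => e1 e2; rewrite !inE => /andP[s1 v1] /andP[s2 v2].
apply: val_inj; have [_ x1 _] := SP _ s1; have [_ x2 _] := SP _ s2.
have [_ ->] := otherP x1; have [_ ->] := otherP x2.
by rewrite -(vo e1) // -(vo e2).
Qed.

(** With c = 8k - 4, the edges of R inside Z number at most 2 c |Z| inside X and
    at most (k - 1) |Z| between X and its complement, hence at most
    (17k - 9) |Z|, and some vertex of Z has at most the average degree. *)
Lemma complement_degenerate Z : Z != set0 ->
  exists2 v, v \in Z & edge_degree (within R Z) v <= 34 * k - 18.
Proof.
move=> Z0; apply/exists_inP; apply: contraT => /exists_inPn big.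
have Z1 : 0 < #|Z| by rewrite card_gt0.
have dense : (34 * k - 17) * #|Z| <= 2 * #|within R Z|.
  rewrite -sum_edge_degree mulnC -sum_nat_const; apply: leq_sum => v /big.
  by rewrite -ltnNge; lia.
pose pend x := [set e in R | (x \in val e) && (other x e \notin X)].
have cover : within R Z \subset
    within R (Z :&: X) :|: \bigcup_(x in Z :&: X) pend x.
  apply/subsetP=> e; rewrite inE => /andP[eR eZ].
  rewrite inE; have [eX|/subsetPn[u ue uX]] := boolP (val e \subset X).
    by rewrite inE eR subsetI eZ eX.
  apply/orP; right; have [nu eu] := otherP ue.
  have oX := uncovered_independent eR ue uX.
  have oe : other u e \in val e by rewrite eu !inE eqxx orbT.
  apply/bigcupP; exists (other u e); first by rewrite inE oX (subsetP eZ).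
  rewrite inE eR oe /=; have [_ eo] := otherP oe.
  by move: ue; rewrite eo in_set2 eq_sym (negbTE nu) => /eqP <-.
have pends : #|\bigcup_(x in Z :&: X) pend x| <= #|Z :&: X| * (k - 1).
  rewrite -sum_nat_const; apply: leq_trans (card_bigcup_leq _ _) _.
  by apply: leq_sum => x /setIP[_ xX]; apply: few_pendants.
have inner := covered_sparse (subsetIr Z X).
have cZX : #|Z :&: X| <= #|Z| by apply/subset_leq_card/subsetIl.
have := leq_trans (subset_leq_card cover) (leq_card_setU _ _); nia.
Qed.

End Maximal.

Theorem theorem1p3 (k : nat) (hk : 2 <= k) (G : sgraph) :
  chromatic_index_mod k G <= 177 * k - 93.
Proof.
pose P H := mod1_set (G := G) k H.
have P0 : P set0.
  by apply/forallP=> v; rewrite edge_degree_eq0 // => e; rewrite inE.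
case: (arg_maxnP (fun H : {set edge G} => #|H|) P0) => H okH maxH.
pose d := 34 * k - 18; pose N := 4 * d + 2 * k - 4.
have k0 : 0 < k by lia.
have d0 : 0 < d by rewrite /d; lia.
have [|f okf] := degenerate_colour (complement_degenerate hk okH maxH) (C := 'I_N) k0 d0.
  by rewrite card_ord.
(* N + 1 = 138k - 75. *)
suff col : chi_colorable k G N.+1.
  rewrite /chromatic_index_mod; case: ex_minnP => n _ /(_ _ col) /leq_trans; apply.
  by rewrite /N /d; lia.
pose F e : 'I_N.+1 := if e \in H then ord_max else widen_ord (leqnSn N) (f e).
apply/existsP; exists [ffun e => F e]; apply/forallP=> c; apply/forall_inP=> v.
set K := color_class _ c => /bigcupP[e0 e0K ve0].
have : 0 < edge_degree K v.
  by apply/card_gt0P; exists e0; rewrite inE e0K.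
suff : class_size_ok k (edge_degree K v).
  by rewrite /class_size_ok; case: (edge_degree K v).
have inK e : (e \in K) = (F e == c) by rewrite inE ffunE.
have [cN|cN] := eqVneq c ord_max.
  rewrite (_ : K = H); first exact: forallP okH v.
  apply/setP=> e; rewrite inK /F cN; case: ifP => // _; first by rewrite eqxx.
  by apply/negbTE; rewrite -val_eqE /= neq_ltn ltn_ord.
have cN' : c < N.
  by have := ltn_ord c; rewrite ltnS leq_eqVlt => /orP[/eqP e|//]; case/eqP: cN; apply: val_inj.
rewrite /edge_degree (_ : [set e in K | v \in val e] =
   [set e in ~: H | (v \in val e) && (f e == Ordinal cN')]); first exact: okf.
apply/setP=> e; rewrite inE inK [RHS]inE inE /F andbC; case: (e \in H) => /=.
  by rewrite eq_sym (negbTE cN) andbF.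
by rewrite -!val_eqE.
Qed.
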